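(* Let $q\ge1$, $n\ge2$, and let $D:n\to n$ be a $\mathrm{PBS}_q$-diagram such that every matrix $U$ appearing in some gate $\gamma_U$ in $D$ is invertible. Then there exists a trace-free $\mathrm{PBS}_q$-diagram $D'$ such that $\mathrm{PBS}\vdash D=D'$.
   Context: Fix an integer $q\ge 1$. Syntax. $\mathrm{PBS}_q$-terms, each of a type $n\to n$ ($n\in\mathbb N$), are generated by: the empty diagram $\varepsilon:0\to0$, the wire $\mathrm{id}:1\to1$, the negation $\neg:1\to1$, the swap $\sigma:2\to2$, the polarising beam splitter $\beta:2\to2$, a gate $\gamma_U:1\to1$ for each $U\in\mathbb C^{q\times q}$; sequential composition $D_2\circ D_1:n\to n$ for $D_1,D_2:n\to n$; parallel composition $D_1\otimes D_2:n+m\to n+m$ for $D_1:n\to n$, $D_2:m\to m$; trace $Tr(D):n\to n$ for $D:n+1\to n+1$. A congruence is a type-preserving equivalence relation on terms compatible with $\circ$, $\otimes$ and $Tr$. Let $I_0=\varepsilon$, $I_{k+1}=I_k\otimes\mathrm{id}$; $\sigma_{1,0}=\mathrm{id}$, $\sigma_{1,k+1}=(I_k\otimes\sigma)\circ(\sigma_{1,k}\otimes\mathrm{id})$; $Tr_0(D)=D$, $Tr_{k+1}(D)=Tr(Tr_k(D))$. Diagrams are terms modulo the structural congruence, the smallest congruence containing all well-typed instances of: $(D_3\circ D_2)\circ D_1=D_3\circ(D_2\circ D_1)$; $I_k\circ D=D=D\circ I_k$; $\varepsilon\otimes D=D=D\otimes\varepsilon$; $(D_1\otimes D_2)\otimes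 D_3=D_1\otimes(D_2\otimes D_3)$; $(D_3\circ D_1)\otimes(D_4\circ D_2)=(D_3\otimes D_4)\circ(D_1\otimes D_2)$; $\sigma_{1,k}\circ(\mathrm{id}\otimes D)=(D\otimes\mathrm{id})\circ\sigma_{1,k}$ for $D:k\to k$; $\sigma\circ\sigma=I_2$; $Tr(D_1\otimes D_2)=D_1\otimes Tr(D_2)$; $Tr(D_2\circ(D_1\otimes\mathrm{id}))=Tr(D_2)\circ D_1$; $Tr((D_2\otimes\mathrm{id})\circ D_1)=D_2\circ Tr(D_1)$; $Tr_k((I_n\otimes D_2)\circ D_1)=Tr_k(D_1\circ(I_n\otimes D_2))$ for $D_2:k\to k$, $D_1:n+k\to n+k$; $Tr(\sigma)=\mathrm{id}$. A diagram is trace-free if it is represented by a term built without $Tr$. Equational theory. $\mathrm{PBS}\vdash\cdot=\cdot$ is the smallest congruence containing the structural congruence and the following equations, for all $U,V\in\mathbb C^{q\times q}$ ($I$ is the identity matrix): (1) $\mathrm{id}=\gamma_I$; (2) $\gamma_U\circ\neg=\neg\circ\gamma_U$; (3) $\beta\circ(\gamma_U\otimes\gamma_U)=(\gamma_U\otimes\gamma_U)\circ\beta$; (4) $Tr((\mathrm{id}\otimes\gamma_V)\circ\beta\circ(\mathrm{id}\otimes\gamma_U)\circ\beta)=Tr((\mathrm{id}\otimes\gamma_U)\circ\beta)$; (5) $(\neg\otimes\neg)\circ\beta\circ(\neg\otimes\neg)=\sigma\circ\beta$; (6) $\gamma_V\circ\gamma_U=\gamma_{VU}$; (7) $Tr(\gamma_U)=\varepsilon$;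 (8) $\beta\circ\beta=\mathrm{id}\otimes\mathrm{id}$; (9) $(\beta\otimes\mathrm{id})\circ(\mathrm{id}\otimes\beta)\circ(\beta\otimes\mathrm{id})=(\sigma\otimes\mathrm{id})\circ(\mathrm{id}\otimes\beta)\circ(\sigma\otimes\mathrm{id})$; (10) $\beta\circ(\neg\otimes\mathrm{id})\circ\beta=(\neg\otimes\mathrm{id})\circ\beta\circ(\neg\otimes\mathrm{id})$. *)

(* Defs.v *)
From HB Require Import structures.
From mathcomp Require Import all_boot all_order all_algebra.
From mathcomp Require Import reals.
From mathcomp.real_closed Require Import complex.

Set Implicit Arguments.
Unset Strict Implicit.
Unset Printing Implicit Defensive.

Import GRing.Theory.
Local Open Scope ring_scope.
Local Open Scope complex_scope.

Declare Scope pbs_scope.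
Delimit Scope pbs_scope with pbs.

(* Raw syntax, with C rendered as R[i] for R : realType. Types are assigned by
   [has_type] rather than by indexing [term] with a natural number, so that
   laws such as associativity of the parallel composition need no casts
   between (n + m) + k and n + (m + k). *)
Inductive term (R : realType) (q : nat) : Type :=
| Empty
| Wire
| Neg
| Swap
| Beam
| Gate of 'M[R[i]]_q
| Seq of term R q & term R q
| Par of term R q & term R q
| Tr of term R q.

Arguments Empty {R q}.
Arguments Wire {R q}.
Arguments Neg {R q}.
Arguments Swap {R q}.
Arguments Beam {R q}.
Arguments Gate {R q} U.
Arguments Seq {R q} D2 D1.
Arguments Par {R q} D1 D2.
Arguments Tr {R q} D.

Bind Scope pbs_scope with term.

Notation "D2 ∘ D1" := (Seq D2 D1) (at level 45, left associativity) : pbs_scope.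
Notation "D1 ⊗ D2" := (Par D1 D2) (at level 40, left associativity) : pbs_scope.
Local Open Scope pbs_scope.

Inductive has_type (R : realType) (q : nat) : term R q -> nat -> Prop :=
| type_Empty : has_type Empty 0
| type_Wire : has_type Wire 1
| type_Neg : has_type Neg 1
| type_Swap : has_type Swap 2
| type_Beam : has_type Beam 2
| type_Gate U : has_type (Gate U) 1
| type_Seq n D2 D1 :
    has_type D2 n -> has_type D1 n -> has_type (D2 ∘ D1) n
| type_Par n m D1 D2 :
    has_type D1 n -> has_type D2 m -> has_type (D1 ⊗ D2) (n + m)%N
| type_Tr n D : has_type D (n + 1)%N -> has_type (Tr D) n.

Fixpoint wires {R : realType} {q : nat} (k : nat) : term R q :=
  if k is k'.+1 then wires k' ⊗ Wire else Empty.

(* The swap of the first wire past the k following ones, of type 1 + k. *)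
Fixpoint swap1 {R : realType} {q : nat} (k : nat) : term R q :=
  if k is k'.+1 then (wires k' ⊗ Swap) ∘ (swap1 k' ⊗ Wire) else Wire.

Definition iter_Tr (R : realType) (q k : nat) (D : term R q) : term R q :=
  iter k Tr D.

Fixpoint gate_in (R : realType) (q : nat) (U : 'M[R[i]]_q) (D : term R q) :
    Prop :=
  match D with
  | Gate V => U = V
  | D2 ∘ D1 => gate_in U D2 \/ gate_in U D1
  | D1 ⊗ D2 => gate_in U D1 \/ gate_in U D2
  | Tr D1 => gate_in U D1
  | _ => False
  end.

Fixpoint trace_free_term (R : realType) (q : nat) (D : term R q) : bool :=
  match D with
  | D2 ∘ D1 => trace_free_term D2 && trace_free_term D1
  | D1 ⊗ D2 => trace_free_term D1 && trace_free_term D2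
  | Tr _ => false
  | _ => true
  end.

(* [congruence_closure E n] is the part in type n of the smallest congruence
   containing E, where [E n s t] relates terms s and t of type n. *)
Inductive congruence_closure (R : realType) (q : nat)
    (E : nat -> term R q -> term R q -> Prop) :
    nat -> term R q -> term R q -> Prop :=
| cong_base n s t : E n s t -> congruence_closure E n s t
| cong_refl n s : has_type s n -> congruence_closure E n s s
| cong_sym n s t : congruence_closure E n s t -> congruence_closure E n t s
| cong_trans n s t u :
    congruence_closure E n s t -> congruence_closure E n t u ->
    congruence_closure E n s u
| cong_Seq n s2 t2 s1 t1 :
    congruence_closure E n s2 t2 -> congruence_closure E n s1 t1 ->
    congruence_closure E n (s2 ∘ s1) (t2 ∘ t1)
| cong_Par n m s1 t1 s2 t2 :
    congruence_closure E n s1 t1 -> congruence_closure E m s2 t2 ->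
    congruence_closure E (n + m)%N (s1 ⊗ s2) (t1 ⊗ t2)
| cong_Tr n s t :
    congruence_closure E (n + 1)%N s t -> congruence_closure E n (Tr s) (Tr t).

Inductive structural_axiom (R : realType) (q : nat) :
    nat -> term R q -> term R q -> Prop :=
| ax_Seq_assoc n D1 D2 D3 :
    has_type D1 n -> has_type D2 n -> has_type D3 n ->
    structural_axiom n ((D3 ∘ D2) ∘ D1) (D3 ∘ (D2 ∘ D1))
| ax_Seq_wires_l k D :
    has_type D k -> structural_axiom k (wires k ∘ D) D
| ax_Seq_wires_r k D :
    has_type D k -> structural_axiom k (D ∘ wires k) D
| ax_Par_Empty_l n D :
    has_type D n -> structural_axiom n (Empty ⊗ D) D
| ax_Par_Empty_r n D :
    has_type D n -> structural_axiom n (D ⊗ Empty) D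
| ax_Par_assoc n m k D1 D2 D3 :
    has_type D1 n -> has_type D2 m -> has_type D3 k ->
    structural_axiom (n + m + k)%N ((D1 ⊗ D2) ⊗ D3) (D1 ⊗ (D2 ⊗ D3))
| ax_interchange n m D1 D2 D3 D4 :
    has_type D1 n -> has_type D3 n -> has_type D2 m -> has_type D4 m ->
    structural_axiom (n + m)%N
      ((D3 ∘ D1) ⊗ (D4 ∘ D2)) ((D3 ⊗ D4) ∘ (D1 ⊗ D2))
| ax_swap_natural k D :
    has_type D k ->
    structural_axiom (1 + k)%N (swap1 k ∘ (Wire ⊗ D)) ((D ⊗ Wire) ∘ swap1 k)
| ax_swap_involutive :
    structural_axiom 2 (Swap ∘ Swap) (wires 2)
| ax_superposing n m D1 D2 :
    has_type D1 n -> has_type D2 (m + 1)%N ->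
    structural_axiom (n + m)%N (Tr (D1 ⊗ D2)) (D1 ⊗ Tr D2)
| ax_tightening_in n D1 D2 :
    has_type D1 n -> has_type D2 (n + 1)%N ->
    structural_axiom n (Tr (D2 ∘ (D1 ⊗ Wire))) (Tr D2 ∘ D1)
| ax_tightening_out n D1 D2 :
    has_type D1 (n + 1)%N -> has_type D2 n ->
    structural_axiom n (Tr ((D2 ⊗ Wire) ∘ D1)) (D2 ∘ Tr D1)
| ax_sliding n k D1 D2 :
    has_type D1 (n + k)%N -> has_type D2 k ->
    structural_axiom n
      (iter_Tr k ((wires n ⊗ D2) ∘ D1)) (iter_Tr k (D1 ∘ (wires n ⊗ D2)))
| ax_yanking :
    structural_axiom 1 (Tr Swap) Wire.

(* PBS-diagrams of type n are the terms of type n modulo [structural n]; they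
   are handled below through representatives. *)
Definition structural (R : realType) (q : nat) :
    nat -> term R q -> term R q -> Prop :=
  congruence_closure (@structural_axiom R q).

Inductive pbs_axiom (R : realType) (q : nat) :
    nat -> term R q -> term R q -> Prop :=
| pbs_id :
    pbs_axiom 1 Wire (Gate 1%:M)
| pbs_Gate_Neg U :
    pbs_axiom 1 (Gate U ∘ Neg) (Neg ∘ Gate U)
| pbs_Beam_Gate U :
    pbs_axiom 2 (Beam ∘ (Gate U ⊗ Gate U)) ((Gate U ⊗ Gate U) ∘ Beam)
| pbs_loop U V :
    pbs_axiom 1 (Tr ((Wire ⊗ Gate V) ∘ Beam ∘ (Wire ⊗ Gate U) ∘ Beam))
                (Tr ((Wire ⊗ Gate U) ∘ Beam))
| pbs_Neg_Beam_Neg :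
    pbs_axiom 2 ((Neg ⊗ Neg) ∘ Beam ∘ (Neg ⊗ Neg)) (Swap ∘ Beam)
| pbs_Gate_mul U V :
    pbs_axiom 1 (Gate V ∘ Gate U) (Gate (V *m U))
| pbs_Tr_Gate U :
    pbs_axiom 0 (Tr (Gate U)) Empty
| pbs_Beam_Beam :
    pbs_axiom 2 (Beam ∘ Beam) (Wire ⊗ Wire)
| pbs_Beam3 :
    pbs_axiom 3 ((Beam ⊗ Wire) ∘ (Wire ⊗ Beam) ∘ (Beam ⊗ Wire))
                ((Swap ⊗ Wire) ∘ (Wire ⊗ Beam) ∘ (Swap ⊗ Wire))
| pbs_Beam_Neg_Beam :
    pbs_axiom 2 (Beam ∘ (Neg ⊗ Wire) ∘ Beam)
                ((Neg ⊗ Wire) ∘ Beam ∘ (Neg ⊗ Wire)).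

Definition pbs_eq (R : realType) (q : nat) :
    nat -> term R q -> term R q -> Prop :=
  congruence_closure (fun n s t => structural n s t \/ pbs_axiom n s t).

Notation "'PBS' ⊢ s ≡ t : n" := (pbs_eq n s t)
  (at level 70, s at level 69, t at level 69, n at level 69,
   format "'PBS'  ⊢  s  ≡  t  :  n") : type_scope.

(* The diagram represented by D, of type n, is trace-free. *)
Definition trace_free (R : realType) (q n : nat) (D : term R q) : Prop :=
  exists D0 : term R q, structural n D D0 /\ trace_free_term D0.

Lemma wires_type (R : realType) (q k : nat) : has_type (@wires R q k) k.
Proof.
elim: k => [|k IH] /=; first exact: type_Empty.
by rewrite -addn1; apply: type_Par => //; exact: type_Wire.
Qed.

Lemma swap1_type (R : realType) (q k : nat) :
  has_type (@swap1 R q k) (1 + k)%N.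
Proof.
elim: k => [|k IH] /=; first exact: type_Wire.
apply: type_Seq.
  rewrite (_ : 1 + k.+1 = k + 2)%N; last by rewrite add1n addn2.
  by apply: type_Par; [exact: wires_type | exact: type_Swap].
rewrite (_ : 1 + k.+1 = 1 + k + 1)%N; last by rewrite addn1 addnS.
by apply: type_Par => //; exact: type_Wire.
Qed.

Lemma iter_Tr_type (R : realType) (q n k : nat) (D : term R q) :
  has_type D (n + k)%N -> has_type (iter_Tr k D) n.
Proof.
elim: k n => [|k IH] n /=; first by rewrite addn0.
by move=> h; apply: type_Tr; apply: IH; rewrite -addnA add1n.
Qed.

Lemma congruence_closure_type (R : realType) (q : nat)
    (E : nat -> term R q -> term R q -> Prop) :
  (forall n s t, E n s t -> has_type s n /\ has_type t n) ->
  forall n s t, congruence_closure E n s t -> has_type s n /\ has_type t n.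
Proof.
move=> hE n s t; elim=> {n s t}.
- exact: hE.
- by [].
- by move=> n s t _ [].
- by move=> n s t u _ [? _] _ [].
- by move=> n s2 t2 s1 t1 _ [? ?] _ [? ?]; split; apply: type_Seq.
- by move=> n m s1 t1 s2 t2 _ [? ?] _ [? ?]; split; apply: type_Par.
- by move=> n s t _ [? ?]; split; apply: type_Tr.
Qed.

Lemma structural_type (R : realType) (q n : nat) (s t : term R q) :
  structural n s t -> has_type s n /\ has_type t n.
Proof.
apply: congruence_closure_type => {}n {}s {}t.
have W k : has_type (@wires R q k) k by exact: wires_type.
have S k : has_type (@swap1 R q k) (1 + k)%N by exact: swap1_type.
have T1 : has_type (@Wire R q) 1 by exact: type_Wire.
case=> {n s t}.
- by move=> *; split; do 2?apply: type_Seq => //.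
- by move=> *; split => //; apply: type_Seq.
- by move=> *; split => //; apply: type_Seq.
- by move=> n D h; split => //; rewrite -[n]add0n; apply: type_Par => //;
    exact: type_Empty.
- by move=> n D h; split => //; rewrite -[n]addn0; apply: type_Par => //;
    exact: type_Empty.
- move=> *; split; first by do 2?apply: type_Par.
  by rewrite -addnA; do 2?apply: type_Par.
- move=> *; split; first by apply: type_Par; apply: type_Seq.
  by apply: type_Seq; apply: type_Par.
- move=> k D h; split; apply: type_Seq => //; first exact: type_Par.
  by rewrite addnC; apply: type_Par.
- by split; [apply: type_Seq; exact: type_Swap | exact: (W 2)].
- move=> *; split; first by apply: type_Tr; rewrite -addnA; apply: type_Par.
  by apply: type_Par => //; apply: type_Tr.
- move=> *; split; last by apply: type_Seq => //; apply: type_Tr.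
  by apply: type_Tr; apply: type_Seq => //; apply: type_Par.
- move=> *; split; last by apply: type_Seq => //; apply: type_Tr.
  by apply: type_Tr; apply: type_Seq => //; apply: type_Par.
- by move=> *; split; apply: iter_Tr_type; apply: type_Seq => //;
    apply: type_Par.
- by split=> //; apply: type_Tr; exact: type_Swap.
Qed.

Lemma pbs_eq_type (R : realType) (q n : nat) (s t : term R q) :
  PBS ⊢ s ≡ t : n -> has_type s n /\ has_type t n.
Proof.
apply: congruence_closure_type => {}n {}s {}t [|]; first exact: structural_type.
have P (m k : nat) (a b : term R q) :
  has_type a m -> has_type b k -> has_type (a ⊗ b) (m + k)%N.
  exact: type_Par.
have P11 a b : has_type a 1 -> has_type b 1 -> has_type (a ⊗ b) 2 := P 1 1 a b.
have P12 a b : has_type a 1 -> has_type b 2 -> has_type (a ⊗ b) 3 := P 1 2 a b.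
have P21 a b : has_type a 2 -> has_type b 1 -> has_type (a ⊗ b) 3 := P 2 1 a b.
case; move=> *; split;
  do ![exact: type_Wire | exact: type_Gate | exact: type_Neg | exact: type_Beam
      | exact: type_Swap | exact: type_Empty | apply: type_Seq | apply: type_Tr
      | apply: P11 | apply: (P12 Wire) | apply: P21].
Qed.

(* The gates appearing in a diagram do not depend on the term chosen to
   represent it. *)
Lemma gate_in_structural (R : realType) (q n : nat) (s t : term R q)
    (U : 'M[R[i]]_q) :
  structural n s t -> gate_in U s <-> gate_in U t.
Proof.
have W k : gate_in U (@wires R q k) <-> False by elim: k => //= k; tauto.
have T k (D : term R q) : gate_in U (iter_Tr k D) <-> gate_in U D.
  by elim: k.
elim=> {n s t} /=; try tauto.
move=> n s t; case=> {n s t} /=; try tauto.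
- by move=> k D; have := W k; tauto.
- by move=> k D; have := W k; tauto.
- move=> n k D1 D2 _ _; have := W n.
  have := T k ((wires n ⊗ D2) ∘ D1); have := T k (D1 ∘ (wires n ⊗ D2)).
  by rewrite /=; tauto.
Qed.

(* Main.v *)
(** A particle on [n] wires is in one of the [2n] modes [V_i], [H_i]; the beam
    splitter exchanges [H_i] and [H_(i+1)], the negation [V_i] and [H_i]. Using a
    trace one can apply a gate [U] to a single mode, as the other polarisation
    stays in the loop. The axioms show that every diagram with invertible gates
    is a word in the Coxeter generators of the symmetric group on the modes and
    in these single-mode gates: the trace of a word on [n+1] wires is again such
    a word, because peeling the two modes of the traced wire off the word leaves
    one of seven small diagrams (the double cosets of S_(2n) in S_(2n+2)), whose
    traces are computed by hand. Finally, an invertible complex matrix is a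
    square S^2, and when [n >= 2] there is a third mode with which the gate S^2
    on a single mode is a product of three gates S, S, S^-1, each acting on two
    modes, which need no trace. *)

From HB Require Import structures.
Require Import Defs.
From mathcomp Require Import all_boot all_order all_algebra.
From mathcomp Require Import generic_quotient boolp reals zify ring.
From mathcomp.real_closed Require Import complex.

Set Implicit Arguments.
Unset Strict Implicit.
Unset Printing Implicit Defensive.

Import GRing.Theory Num.Theory.
Local Open Scope ring_scope.
Local Open Scope complex_scope.
Local Open Scope quotient_scope.

(** * Terms modulo the equational theory *)

Section Quotient.
Variables (R : realType) (q : nat).
Notation term := (term R q).
Implicit Types s t : term.

(** Without traces a gate acts on both polarisations of its wire, so, counted by modes, gates come
    in pairs. Three modes are the fewest in which pairs can isolate one: S on {V_0, H_0} and on
    {H_0, H_1}, S^-1 on {V_0, H_1}. What remains on H_0 is a square, whence the square root; a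
    single wire, with two modes, leaves no room for this. A double coset records which modes of the
    traced wire are sent back to it, a partial matching of two modes with two modes: both return in
    2 ways, one in 4, none in 1. A mode that returns to itself carries its gate on a closed loop. To
    make this gate vanish, it is traded for a plain gate and an inverse on the other polarisation;
    here invertibility enters. When the two modes return exchanged, a square root is needed again,
    to spread the gate evenly over the loop. The trace equations come from conjugation: a
    permutation of modes that commutes with the gates can be slid around the loops. *)

Fixpoint arity (s : term) : nat :=
  match s with
  | Empty => 0
  | Swap | Beam => 2
  | Wire | Neg | Gate _ => 1
  | Seq a _ => arity a
  | Par a b => arity a + arity b
  | Tr a => (arity a).-1
  end.

Lemma has_type_arity s n : has_type s n -> n = arity s.
Proof.
elim=> //= {s n}; first by move=> n m a b _ -> _ ->.
by move=> n a _ <-; rewrite addn1.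
Qed.

Lemma has_type_unique s n m : has_type s n -> has_type s m -> n = m.
Proof. by move=> /has_type_arity -> /has_type_arity. Qed.

Lemma has_type_Seq s t n : has_type (Seq s t) n <-> has_type s n /\ has_type t n.
Proof. by split=> [h|[hs ht]]; [inversion h | apply: type_Seq]. Qed.

Lemma has_type_Par s t n : has_type (Par s t) n <->
  exists m k, [/\ has_type s m, has_type t k & n = (m + k)%N].
Proof.
split=> [h|[m [k [hs ht ->]]]]; last exact: type_Par.
by inversion h as [| | | | | | |m k a b ha hb|]; exists m, k.
Qed.

Lemma has_type_Tr s n : has_type (Tr s) n <-> has_type s (n + 1)%N.
Proof. by split=> [h|hs]; [inversion h | apply: type_Tr]. Qed.

(* All ill-typed terms are identified, which makes the operations below total
   and spares typing hypotheses in most equations. *)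
Definition equivp s t : Prop :=
  forall n, has_type s n \/ has_type t n -> PBS ⊢ s ≡ t : n.

Definition equivb s t : bool := `[< equivp s t >].

Lemma equivb_refl : reflexive equivb.
Proof. by move=> s; apply/asboolP => n [] h; apply: cong_refl. Qed.

Lemma equivb_sym : symmetric equivb.
Proof.
by move=> s t; apply/asboolP/asboolP => h n hn; apply: cong_sym; apply: h;
  case: hn; [right | left | right | left].
Qed.

Lemma equivb_trans : transitive equivb.
Proof.
move=> t s u /asboolP st /asboolP tu; apply/asboolP => n [h|h].
  have e := st n (or_introl h); apply: (cong_trans e).
  by apply: tu; left; case: (pbs_eq_type e).
have e := tu n (or_intror h); have [ht _] := pbs_eq_type e.
by apply: cong_trans e; apply: st; right.
Qed.

HB.instance Definition _ := gen_eqMixin term.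
HB.instance Definition _ := gen_choiceMixin term.

Canonical equivb_equiv :=
  EquivRel equivb equivb_refl equivb_sym equivb_trans.

Definition diag := {eq_quot equivb}.

Definition cls (s : term) : diag := \pi s.

Lemma clsE s t : cls s = cls t <-> equivp s t.
Proof.
split=> [/eqP|h]; first by rewrite /cls piE => /asboolP.
by apply/eqP; rewrite /cls piE; apply/asboolP.
Qed.

Lemma cls_repr (x : diag) : cls (repr x) = x.
Proof. exact: reprK. Qed.

Lemma repr_cls s : equivp (repr (cls s)) s.
Proof. by apply/clsE; rewrite cls_repr. Qed.

Lemma cls_eq n s t : PBS ⊢ s ≡ t : n -> cls s = cls t.
Proof.
move=> e; apply/clsE => m; have [hs ht] := pbs_eq_type e.
by case=> [/(has_type_unique hs)|/(has_type_unique ht)] <-.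
Qed.

Lemma cls_structural n s t : structural_axiom n s t -> cls s = cls t.
Proof. by move=> e; apply: (@cls_eq n); apply: cong_base; left; apply: cong_base. Qed.

Lemma cls_pbs n s t : pbs_axiom n s t -> cls s = cls t.
Proof. by move=> e; apply: (@cls_eq n); apply: cong_base; right. Qed.

Lemma cls_junk s t : (forall n, ~ has_type s n) -> (forall n, ~ has_type t n) ->
  cls s = cls t.
Proof. by move=> hs ht; apply/clsE => n [/hs|/ht]. Qed.

Lemma cls_eqP n s t : has_type s n -> cls s = cls t -> PBS ⊢ s ≡ t : n.
Proof. by move=> h /clsE; apply; left. Qed.

Definition ty n (x : diag) := has_type (repr x) n.

Lemma ty_cls n s : ty n (cls s) <-> has_type s n.
Proof.
split=> h; [have e := repr_cls (s := s) (or_introl h) |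
            have e := repr_cls (s := s) (or_intror h)];
  by case: (pbs_eq_type e).
Qed.

(** [locked] keeps rewriting from unfolding a composite into representatives. *)
Definition seqd (x y : diag) : diag := locked (cls (Seq (repr x) (repr y))).
Definition pard (x y : diag) : diag := locked (cls (Par (repr x) (repr y))).
Definition trd (x : diag) : diag := locked (cls (Tr (repr x))).

Lemma cls_Seq s t : cls (Seq s t) = seqd (cls s) (cls t).
Proof.
rewrite /seqd -lock; apply/clsE => n h; apply: cong_Seq;
  (apply: cong_sym; apply: repr_cls);
  by case: h => /has_type_Seq []; [right | left].
Qed.

Lemma cls_Par s t : cls (Par s t) = pard (cls s) (cls t).
Proof.
rewrite /pard -lock; apply/clsE => n [] /has_type_Par [m [k [hs ht ->]]];
  by apply: cong_Par; apply: cong_sym; apply: repr_cls; (try by left); right.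
Qed.

Lemma cls_Tr s : cls (Tr s) = trd (cls s).
Proof.
rewrite /trd -lock; apply/clsE => n h; apply: cong_Tr; apply: cong_sym; apply: repr_cls.
by case: h => /has_type_Tr; [right | left].
Qed.

Definition idd k : diag := cls (wires k).
Definition epsd : diag := cls Empty.
Definition w : diag := cls Wire.
Definition ng : diag := cls Neg.
Definition sw : diag := cls Swap.
Definition bs : diag := cls Beam.
Definition ga U : diag := cls (Gate U).

(** When the two sides are well typed together, an axiom holds for all classes without typing
    hypotheses: in the ill-typed case both sides are the one class of ill-typed terms. *)
Lemma cls_structural_partial s t :
    (forall n, has_type s n -> structural_axiom n s t) ->
    (forall n, has_type t n -> has_type s n) -> cls s = cls t.
Proof.
move=> hs ht; have [[n h]|h] := pselect (exists n, has_type s n).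
  by apply: cls_structural; apply: hs h.
by apply: cls_junk => n hn; apply: h; exists n => //; apply: ht.
Qed.

End Quotient.

Arguments w {R q}.
Arguments ng {R q}.
Arguments sw {R q}.
Arguments bs {R q}.
Arguments epsd {R q}.
Arguments idd {R q} k.

Declare Scope diag_scope.
Delimit Scope diag_scope with diag.
Bind Scope diag_scope with diag.
Notation "x ∘ y" := (seqd x y) (at level 45, left associativity) : diag_scope.
Notation "x ⊗ y" := (pard x y) (at level 40, left associativity) : diag_scope.
Local Open Scope diag_scope.

Section Typing.
Variables (R : realType) (q : nat).
Implicit Types x y z : diag R q.

Lemma diag_ind (P : diag R q -> Prop) : (forall s, P (cls s)) -> forall x, P x.
Proof. by move=> h x; rewrite -[x]cls_repr. Qed.

Lemma ty_cast m n x : ty m x -> n = m -> ty n x.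
Proof. by move=> h ->. Qed.

Lemma ty_seqE n x y : ty n (x ∘ y) <-> ty n x /\ ty n y.
Proof. by rewrite /seqd -lock ty_cls has_type_Seq. Qed.

Lemma ty_seq n x y : ty n x -> ty n y -> ty n (x ∘ y).
Proof. by rewrite ty_seqE. Qed.

Lemma ty_parE n x y :
  ty n (x ⊗ y) <-> exists m k, [/\ ty m x, ty k y & n = (m + k)%N].
Proof. by rewrite /pard -lock ty_cls has_type_Par. Qed.

Lemma ty_par m k n x y : ty m x -> ty k y -> n = (m + k)%N -> ty n (x ⊗ y).
Proof. by move=> hx hy e; apply/ty_parE; exists m, k. Qed.

Lemma ty_tr m n x : ty m x -> (0 < m)%N -> n = m.-1 -> ty n (trd x).
Proof.
move=> hx m0 ->; rewrite /trd -lock; apply/ty_cls/has_type_Tr.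
by rewrite addn1 prednK.
Qed.

Lemma ty_idd n k : n = k -> ty n (@idd R q k).
Proof. by move=> ->; apply/ty_cls/wires_type. Qed.

Lemma ty_eps n : n = 0 -> ty n (@epsd R q).
Proof. by move=> ->; apply/ty_cls; constructor. Qed.

Lemma ty_w n : n = 1 -> ty n (@w R q).
Proof. by move=> ->; apply/ty_cls; constructor. Qed.

Lemma ty_ng n : n = 1 -> ty n (@ng R q).
Proof. by move=> ->; apply/ty_cls; constructor. Qed.

Lemma ty_ga n U : n = 1 -> ty n (@ga R q U).
Proof. by move=> ->; apply/ty_cls; constructor. Qed.

Lemma ty_sw n : n = 2 -> ty n (@sw R q).
Proof. by move=> ->; apply/ty_cls; constructor. Qed.

Lemma ty_bs n : n = 2 -> ty n (@bs R q).
Proof. by move=> ->; apply/ty_cls; constructor. Qed.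

End Typing.

Ltac arith := first [reflexivity | lia].

Create HintDb tydb.
#[export] Hint Extern 0 (ty _ _) =>
  (first [ apply: ty_w | apply: ty_ng | apply: ty_ga | apply: ty_sw | apply: ty_bs
         | apply: ty_idd | apply: ty_eps ]; arith) : tydb.

Ltac typ :=
  lazymatch goal with
  | |- ty _ (seqd _ _) => apply: ty_seq; typ
  | |- ty _ (pard _ _) => eapply ty_par; [typ | typ | arith]
  | |- ty _ (trd _) => eapply ty_tr; [typ | arith | arith]
  | |- ty _ _ => first [ eassumption
                       | eapply ty_cast; [eassumption | arith]
                       | solve [eauto 1 with tydb nocore] ]
  | _ => idtac
  end.

Ltac to_cls := do 4 rewrite -?cls_Seq -?cls_Par -?cls_Tr.

(** * The structural laws and the equational axioms, on classes *)

Section Laws.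
Variables (R : realType) (q : nat).
Implicit Types x y z a b c d : diag R q.

Lemma seqA x y z : x ∘ (y ∘ z) = x ∘ y ∘ z.
Proof.
elim/diag_ind: x => x; elim/diag_ind: y => y; elim/diag_ind: z => z.
rewrite -!cls_Seq; apply/esym/cls_structural_partial => n.
  by move=> /has_type_Seq[/has_type_Seq[? ?] ?]; apply: ax_Seq_assoc.
by move=> /has_type_Seq[? /has_type_Seq[? ?]]; do 2?apply: type_Seq.
Qed.

Lemma parA x y z : x ⊗ (y ⊗ z) = x ⊗ y ⊗ z.
Proof.
elim/diag_ind: x => x; elim/diag_ind: y => y; elim/diag_ind: z => z.
rewrite -!cls_Par; apply/esym/cls_structural_partial => n.
  move=> /has_type_Par[? [? [/has_type_Par[? [? [? ? ->]]] ? ->]]].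
  exact: ax_Par_assoc.
move=> /has_type_Par[? [? [? /has_type_Par[? [? [? ? ->]]] ->]]].
by rewrite addnA; do 2?apply: type_Par.
Qed.

Lemma par_eps x : x ⊗ epsd = x.
Proof.
elim/diag_ind: x => x; rewrite -cls_Par; apply: cls_structural_partial => n h.
  move/has_type_Par: h => [m [k [? /has_type_arity /= -> ->]]].
  by rewrite addn0; apply: ax_Par_Empty_r.
by rewrite -[n]addn0; apply: type_Par => //; apply: type_Empty.
Qed.

Lemma eps_par x : epsd ⊗ x = x.
Proof.
elim/diag_ind: x => x; rewrite -cls_Par; apply: cls_structural_partial => n h.
  move/has_type_Par: h => [m [k [/has_type_arity /= -> ? ->]]].
  exact: ax_Par_Empty_l.
by rewrite -[n]add0n; apply: type_Par => //; apply: type_Empty.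
Qed.

Lemma idd0 : idd 0 = epsd :> diag R q. Proof. by []. Qed.

Lemma iddS k : idd k.+1 = idd k ⊗ w :> diag R q.
Proof. by rewrite /idd /= cls_Par. Qed.

Lemma idd1 : idd 1 = w :> diag R q.
Proof. by rewrite iddS idd0 eps_par. Qed.

Lemma idd2 : idd 2 = w ⊗ w :> diag R q.
Proof. by rewrite iddS idd1. Qed.

Lemma idd_add m k : idd (m + k) = idd m ⊗ idd k :> diag R q.
Proof.
elim: k => [|k IH]; first by rewrite addn0 idd0 par_eps.
by rewrite addnS !iddS IH parA.
Qed.

Lemma seq1d k x : ty k x -> idd k ∘ x = x.
Proof.
elim/diag_ind: x => x /ty_cls h; rewrite -cls_Seq.
exact/cls_structural/ax_Seq_wires_l.
Qed.

Lemma seqd1 k x : ty k x -> x ∘ idd k = x.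
Proof.
elim/diag_ind: x => x /ty_cls h; rewrite -cls_Seq.
exact/cls_structural/ax_Seq_wires_r.
Qed.

(** Typing cannot be dropped here: the right-hand side is also well typed when [a] and [c] differ in
    type and only the sums agree. *)
Lemma par_seq n m a b c d : ty n a -> ty n c -> ty m b -> ty m d ->
  (a ∘ c) ⊗ (b ∘ d) = (a ⊗ b) ∘ (c ⊗ d).
Proof.
elim/diag_ind: a => a; elim/diag_ind: b => b; elim/diag_ind: c => c.
elim/diag_ind: d => d /ty_cls ? /ty_cls ? /ty_cls ? /ty_cls ?.
to_cls; apply/cls_structural/ax_interchange; eassumption.
Qed.

Lemma tr_super n m x y : ty n x -> ty m.+1 y -> trd (x ⊗ y) = x ⊗ trd y.
Proof.
elim/diag_ind: x => x; elim/diag_ind: y => y /ty_cls ? /ty_cls; rewrite -addn1 => ?.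
to_cls; apply/cls_structural/ax_superposing; eassumption.
Qed.

Lemma tr_in n x y : ty n y -> ty n.+1 x -> trd (x ∘ (y ⊗ w)) = trd x ∘ y.
Proof.
elim/diag_ind: x => x; elim/diag_ind: y => y /ty_cls ? /ty_cls; rewrite -addn1 => ?.
to_cls; apply/cls_structural/ax_tightening_in; eassumption.
Qed.

Lemma tr_out n x y : ty n y -> ty n.+1 x -> trd ((y ⊗ w) ∘ x) = y ∘ trd x.
Proof.
elim/diag_ind: x => x; elim/diag_ind: y => y /ty_cls ? /ty_cls; rewrite -addn1 => ?.
to_cls; apply/cls_structural/ax_tightening_out; eassumption.
Qed.

Lemma cls_iter_Tr k (s : term R q) : cls (iter_Tr k s) = iter k (@trd R q) (cls s).
Proof. by elim: k => //= k <-; rewrite cls_Tr. Qed.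

Lemma tr_slide n k x y : ty (n + k) x -> ty k y ->
  iter k (@trd R q) ((idd n ⊗ y) ∘ x) = iter k (@trd R q) (x ∘ (idd n ⊗ y)).
Proof.
elim/diag_ind: x => x; elim/diag_ind: y => y /ty_cls ? /ty_cls ?.
rewrite /idd; to_cls; rewrite -!cls_iter_Tr.
apply/cls_structural/ax_sliding; eassumption.
Qed.

Lemma tr_slide1 n x y : ty n.+1 x -> ty 1 y ->
  trd ((idd n ⊗ y) ∘ x) = trd (x ∘ (idd n ⊗ y)).
Proof. by rewrite -addn1 => hx hy; apply: (@tr_slide n 1). Qed.

Lemma tr_slide2 n x y : ty n.+2 x -> ty 2 y ->
  trd (trd ((idd n ⊗ y) ∘ x)) = trd (trd (x ∘ (idd n ⊗ y))).
Proof. by rewrite -addn2 => hx hy; apply: (@tr_slide n 2). Qed.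

Lemma tr_sw : trd sw = w :> diag R q.
Proof. by rewrite -cls_Tr; apply/cls_structural/ax_yanking. Qed.

Lemma sw_sw : sw ∘ sw = idd 2 :> diag R q.
Proof. by rewrite -cls_Seq; apply/cls_structural/ax_swap_involutive. Qed.

Lemma swap_natural k x : ty k x ->
  cls (swap1 k) ∘ (w ⊗ x) = (x ⊗ w) ∘ cls (swap1 k).
Proof.
elim/diag_ind: x => x /ty_cls ?; to_cls.
exact/cls_structural/ax_swap_natural.
Qed.

Lemma ga1 : ga 1%:M = w :> diag R q.
Proof. by apply/esym/cls_pbs/pbs_id. Qed.

Lemma ga_ng U : ga U ∘ ng = ng ∘ ga U :> diag R q.
Proof. by to_cls; apply/cls_pbs/pbs_Gate_Neg. Qed.

Lemma bs_ga U : bs ∘ (ga U ⊗ ga U) = (ga U ⊗ ga U) ∘ bs :> diag R q.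
Proof. by to_cls; apply/cls_pbs/pbs_Beam_Gate. Qed.

Lemma tr_loop U V : trd ((w ⊗ ga V) ∘ bs ∘ (w ⊗ ga U) ∘ bs) =
  trd ((w ⊗ ga U) ∘ bs) :> diag R q.
Proof. by to_cls; apply/cls_pbs/pbs_loop. Qed.

Lemma ng_bs_ng : (ng ⊗ ng) ∘ bs ∘ (ng ⊗ ng) = sw ∘ bs :> diag R q.
Proof. by to_cls; apply/cls_pbs/pbs_Neg_Beam_Neg. Qed.

Lemma ga_mul U V : ga V ∘ ga U = ga (V *m U) :> diag R q.
Proof. by to_cls; apply/cls_pbs/pbs_Gate_mul. Qed.

Lemma tr_ga U : trd (ga U) = epsd :> diag R q.
Proof. by rewrite -cls_Tr; apply/cls_pbs/pbs_Tr_Gate. Qed.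

Lemma bs_bs : bs ∘ bs = idd 2 :> diag R q.
Proof. by rewrite idd2; to_cls; apply/cls_pbs/pbs_Beam_Beam. Qed.

Lemma bs3 : (bs ⊗ w) ∘ (w ⊗ bs) ∘ (bs ⊗ w) =
  (sw ⊗ w) ∘ (w ⊗ bs) ∘ (sw ⊗ w) :> diag R q.
Proof. by to_cls; apply/cls_pbs/pbs_Beam3. Qed.

Lemma bs_ng_bs : bs ∘ (ng ⊗ w) ∘ bs = (ng ⊗ w) ∘ bs ∘ (ng ⊗ w) :> diag R q.
Proof. by to_cls; apply/cls_pbs/pbs_Beam_Neg_Beam. Qed.

End Laws.

Arguments idd0 {R q}.
Arguments idd1 {R q}.
Arguments idd2 {R q}.
Arguments tr_sw {R q}.
Arguments sw_sw {R q}.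
Arguments ga1 {R q}.
Arguments ng_bs_ng {R q}.
Arguments bs_bs {R q}.
Arguments bs3 {R q}.
Arguments bs_ng_bs {R q}.

(** * Beam splitters and negations on at most three wires *)

Section SmallDiagrams.
Variables (R : realType) (q : nat).
Implicit Types x y z a b c d : diag R q.

(** These put an equation under a prefix [c] of a left-associated product, for the tactics [rw] and
    [kill]. *)
Lemma ctx2 x y z : x ∘ y = z -> forall c, c ∘ x ∘ y = c ∘ z.
Proof. by move=> <- c; rewrite !seqA. Qed.

Lemma ctx3 x y z t : x ∘ y ∘ z = t -> forall c, c ∘ x ∘ y ∘ z = c ∘ t.
Proof. by move=> <- c; rewrite !seqA. Qed.

Lemma ctx4 x y z t u : x ∘ y ∘ z ∘ t = u -> forall c, c ∘ x ∘ y ∘ z ∘ t = c ∘ u.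
Proof. by move=> <- c; rewrite !seqA. Qed.

Lemma ctx_cancel n x y : x ∘ y = idd n -> forall c, ty n c -> c ∘ x ∘ y = c.
Proof. by move=> e c hc; rewrite -seqA e seqd1. Qed.

Lemma par_comm n m x y : ty n x -> ty m y ->
  (x ⊗ idd m) ∘ (idd n ⊗ y) = (idd n ⊗ y) ∘ (x ⊗ idd m).
Proof.
move=> hx hy; rewrite -(par_seq (n := n) (m := m)) -?(par_seq (n := n) (m := m)); try typ.
by rewrite !(seq1d (k := n)) // !(seq1d (k := m)) // !(seqd1 (k := n)) // !(seqd1 (k := m)).
Qed.

Lemma par_split n m x y : ty n x -> ty m y ->
  (x ⊗ idd m) ∘ (idd n ⊗ y) = x ⊗ y.
Proof.
move=> hx hy; rewrite -(par_seq (n := n) (m := m)); try typ.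
by rewrite (seq1d (k := m)) // (seqd1 (k := n)).
Qed.

End SmallDiagrams.

(* [rw e] rewrites with [e] modulo associativity, [kill e] cancels two adjacent
   factors whose product is the identity by [e]. *)
Tactic Notation "rw" open_constr(e) := rewrite ?seqA;
  first [rewrite e | rewrite (ctx2 e) | rewrite (ctx3 e) | rewrite (ctx4 e)];
  rewrite ?seqA.
Tactic Notation "kill" open_constr(e) := rewrite ?seqA;
  first [ rewrite (ctx_cancel e); [| solve [typ]]
        | rewrite e; try (rewrite seq1d; [| solve [typ]]) ];
  rewrite ?seqA.
Ltac interchange := repeat (erewrite <- par_seq; [| solve [typ] ..]).

Section SmallDiagrams2.
Variables (R : realType) (q : nat).
Notation diag := (diag R q).

Lemma ng0_ng1 : (ng ⊗ w) ∘ (w ⊗ ng) = ng ⊗ ng :> diag.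
Proof. by rewrite -idd1 par_split //; typ. Qed.

Lemma ng1_ng0 : (w ⊗ ng) ∘ (ng ⊗ w) = ng ⊗ ng :> diag.
Proof. by rewrite -idd1 -par_comm ?par_split //; typ. Qed.

(* By (5), [ng ⊗ w] has a left inverse; then (10) gives
   [bs = bs ∘ (ng ⊗ w) ∘ (ng ⊗ w)]. *)
Lemma ng_ng : ng ∘ ng = w :> diag.
Proof.
have [l tl hl] : exists2 l : diag, ty 2 l & l ∘ (ng ⊗ w) = idd 2.
  exists (bs ∘ sw ∘ (ng ⊗ ng) ∘ bs ∘ (w ⊗ ng)); first by typ.
  by rw ng1_ng0; rw ng_bs_ng; kill sw_sw; kill bs_bs.
have e : (ng ⊗ w) ∘ (ng ⊗ w) = idd 2 :> diag.
  have h : bs ∘ (ng ⊗ w) ∘ (ng ⊗ w) = bs :> diag.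
    have : l ∘ (ng ⊗ w) ∘ bs ∘ (ng ⊗ w) ∘ (ng ⊗ w) = l ∘ (ng ⊗ w) ∘ bs.
      rw (esym bs_ng_bs). rw (esym bs_ng_bs).
      by kill bs_bs.
    by rewrite hl !seq1d; try typ.
  have := congr1 (seqd bs) h; rewrite !seqA bs_bs !seq1d //; typ.
(* Closing the second wire removes it, since the wire is [ga 1%:M], whose trace is [epsd]; the
   equation descends to one wire. *)
have := congr1 (@trd R q) e.
interchange.
rewrite idd2 !(tr_super (n := 1) (m := 0)); try typ.
by rewrite -ga1 ga_mul mulmx1 tr_ga ga1 !par_eps.
Qed.

Lemma ww : w ∘ w = w :> diag.
Proof. by rewrite -{1}idd1 seq1d //; typ. Qed.

Lemma parwl n (x y : diag) : ty n x -> ty n y -> (x ⊗ w) ∘ (y ⊗ w) = (x ∘ y) ⊗ w.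
Proof. by move=> hx hy; rewrite -(par_seq (n := n) (m := 1)) ?ww //; typ. Qed.

Lemma parwr n (x y : diag) : ty n x -> ty n y -> (w ⊗ x) ∘ (w ⊗ y) = w ⊗ (x ∘ y).
Proof. by move=> hx hy; rewrite -(par_seq (n := 1) (m := n)) ?ww //; typ. Qed.

Lemma idd3 : idd 3 = w ⊗ w ⊗ w :> diag.
Proof. by rewrite iddS idd2. Qed.

Lemma ngng_ngng : (ng ⊗ ng) ∘ (ng ⊗ ng) = idd 2 :> diag.
Proof. by interchange; rewrite ng_ng idd2. Qed.

(** By [ng_bs_ng], [sw ∘ bs] is conjugate to the involution [bs], hence an involution; as [sw] and
    [bs] are involutions too, they commute. *)
Lemma sw_bs_sw : sw ∘ bs ∘ sw = bs :> diag.
Proof.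
have e : sw ∘ bs ∘ sw ∘ bs = idd 2 :> diag.
  rw (esym ng_bs_ng); rw (esym ng_bs_ng); kill ngng_ngng; kill bs_bs; exact: ngng_ngng.
by have := congr1 (fun y => y ∘ bs) e; kill bs_bs; rewrite seq1d //; typ.
Qed.

Lemma cls_swap1_1 : cls (swap1 1) = sw :> diag.
Proof.
rewrite /= cls_Seq !cls_Par -/(idd 0) -/w -/sw idd0 eps_par -idd2 seqd1 //; typ.
Qed.

Lemma cls_swap1_2 : cls (swap1 2) = (w ⊗ sw) ∘ (sw ⊗ w) :> diag.
Proof.
have -> : swap1 2 = Seq (Par (wires 1) Swap) (Par (swap1 1) Wire) :> term R q by [].
by rewrite cls_Seq (cls_Par (swap1 1)) (cls_Par (wires 1)) cls_swap1_1 -/(idd 1) idd1.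
Qed.

Lemma sw_par (x : diag) : ty 1 x -> sw ∘ (w ⊗ x) = (x ⊗ w) ∘ sw.
Proof. by move=> /swap_natural; rewrite cls_swap1_1. Qed.

Lemma sw_par' (x : diag) : ty 1 x -> sw ∘ (x ⊗ w) = (w ⊗ x) ∘ sw.
Proof.
move=> hx; have := congr1 (fun y => sw ∘ y ∘ sw) (sw_par hx); rewrite !seqA.
by kill sw_sw => <-; kill sw_sw.
Qed.

Lemma sw_bs : sw ∘ bs = bs ∘ sw :> diag.
Proof. by rewrite -{2}sw_bs_sw; kill sw_sw. Qed.

Lemma sw_ng0 : sw ∘ (ng ⊗ w) = (w ⊗ ng) ∘ sw :> diag.
Proof. by apply: sw_par'; typ. Qed.

Lemma sw_ng1 : sw ∘ (w ⊗ ng) = (ng ⊗ w) ∘ sw :> diag.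
Proof. by apply: sw_par; typ. Qed.

Lemma bs_ng1_bs : bs ∘ (w ⊗ ng) ∘ bs = (w ⊗ ng) ∘ bs ∘ (w ⊗ ng) :> diag.
Proof.
transitivity (sw ∘ (bs ∘ (ng ⊗ w) ∘ bs) ∘ sw : diag).
  by rw sw_bs; rw sw_ng0; rw sw_bs_sw.
by rewrite bs_ng_bs; rw sw_ng0; rw sw_bs; rw sw_ng0; kill sw_sw.
Qed.

(* [bz] is a beam splitter between the first and the third of three wires; it is
   locked, as otherwise rewriting with [seqA] would unfold it. *)
Definition bz : diag := locked ((w ⊗ sw) ∘ (bs ⊗ w) ∘ (w ⊗ sw)).

Lemma bzE : bz = (w ⊗ sw) ∘ (bs ⊗ w) ∘ (w ⊗ sw).
Proof. by rewrite /bz -lock. Qed.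

Lemma ty_bz n : n = 3 -> ty n bz.
Proof. by move=> ->; rewrite bzE; typ. Qed.

Lemma b0b0 : (bs ⊗ w) ∘ (bs ⊗ w) = idd 3 :> diag.
Proof. by interchange; rewrite bs_bs ww -iddS. Qed.

Lemma b1b1 : (w ⊗ bs) ∘ (w ⊗ bs) = idd 3 :> diag.
Proof. by interchange; rewrite bs_bs ww idd2 idd3 parA. Qed.

Lemma s0s0 : (sw ⊗ w) ∘ (sw ⊗ w) = idd 3 :> diag.
Proof. by interchange; rewrite sw_sw ww -iddS. Qed.

Lemma s1s1 : (w ⊗ sw) ∘ (w ⊗ sw) = idd 3 :> diag.
Proof. by interchange; rewrite sw_sw ww idd2 idd3 parA. Qed.

Lemma s0b0 : (sw ⊗ w) ∘ (bs ⊗ w) = (bs ⊗ w) ∘ (sw ⊗ w) :> diag.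
Proof. by interchange; rewrite sw_bs. Qed.

Lemma s1b1 : (w ⊗ sw) ∘ (w ⊗ bs) = (w ⊗ bs) ∘ (w ⊗ sw) :> diag.
Proof. by interchange; rewrite sw_bs. Qed.

Lemma s1s0_par (x : diag) : ty 2 x ->
  (w ⊗ sw) ∘ (sw ⊗ w) ∘ (w ⊗ x) = (x ⊗ w) ∘ (w ⊗ sw) ∘ (sw ⊗ w).
Proof. by move=> /swap_natural; rewrite cls_swap1_2 seqA. Qed.

Lemma braid_sw : (w ⊗ sw) ∘ (sw ⊗ w) ∘ (w ⊗ sw) =
  (sw ⊗ w) ∘ (w ⊗ sw) ∘ (sw ⊗ w) :> diag.
Proof. by apply: s1s0_par; typ. Qed.

Lemma bz_s0 : (sw ⊗ w) ∘ (w ⊗ bs) ∘ (sw ⊗ w) = bz.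
Proof.
have /(congr1 (fun y => (w ⊗ sw) ∘ y ∘ (sw ⊗ w))) : _ := s1s0_par (ty_bs R q erefl).
by rewrite bzE; kill s1s1; kill s0s0.
Qed.

Lemma bz_b0 : (bs ⊗ w) ∘ (w ⊗ bs) ∘ (bs ⊗ w) = bz.
Proof. by rewrite bs3 bz_s0. Qed.

Lemma bzbz : bz ∘ bz = idd 3.
Proof. by rewrite -bz_b0; kill b0b0; kill b1b1; rewrite b0b0. Qed.

Lemma s0s1_par (x : diag) : ty 2 x ->
  (sw ⊗ w) ∘ (w ⊗ sw) ∘ (x ⊗ w) = (w ⊗ x) ∘ (sw ⊗ w) ∘ (w ⊗ sw).
Proof.
move=> hx.
transitivity ((sw ⊗ w) ∘ (w ⊗ sw) ∘ ((x ⊗ w) ∘ (w ⊗ sw) ∘ (sw ⊗ w)) ∘ (sw ⊗ w) ∘ (w ⊗ sw)).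
  by kill s0s0; kill s1s1.
by rewrite -(s1s0_par hx); kill s1s1; kill s0s0.
Qed.

Definition s02 : diag := locked ((w ⊗ sw) ∘ (sw ⊗ w) ∘ (w ⊗ sw)).

Lemma s02E : s02 = (w ⊗ sw) ∘ (sw ⊗ w) ∘ (w ⊗ sw).
Proof. by rewrite /s02 -lock. Qed.

Lemma ty_s02 n : n = 3 -> ty n s02.
Proof. by move=> ->; rewrite s02E; typ. Qed.

Lemma s02s02 : s02 ∘ s02 = idd 3.
Proof. by rewrite s02E; kill s1s1; kill s0s0; rewrite s1s1. Qed.

Lemma s02b0 : s02 ∘ (bs ⊗ w) = (w ⊗ bs) ∘ s02.
Proof.
by rewrite s02E braid_sw; rw s0b0; rw (s0s1_par (ty_bs R q erefl)).
Qed.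

Lemma s02b1 : s02 ∘ (w ⊗ bs) = (bs ⊗ w) ∘ s02.
Proof. by rewrite s02E; rw s1b1; rw (s1s0_par (ty_bs R q erefl)). Qed.

Lemma s02bz : s02 ∘ bz = bz ∘ s02.
Proof.
by rewrite -bz_s0 s02E braid_sw; kill s0s0; rw s1b1; kill s0s0.
Qed.

(** Mirror image of [bz_b0]: conjugation by [s02], which reverses the three wires, exchanges the two
    adjacent beam splitters and fixes [bz]. *)
Lemma bz_b1 : (w ⊗ bs) ∘ (bs ⊗ w) ∘ (w ⊗ bs) = bz.
Proof.
transitivity (s02 ∘ bz ∘ s02); last first.
  by have tb := ty_bz erefl; rewrite s02bz; kill s02s02.
rewrite -bz_b0; rw s02b0; rw s02b1; rw s02b0.
by kill s02s02.
Qed.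

Lemma s1n1 : (w ⊗ sw) ∘ (w ⊗ ng ⊗ w) = (w ⊗ w ⊗ ng) ∘ (w ⊗ sw) :> diag.
Proof. by rewrite -!parA; interchange; rewrite sw_ng0. Qed.

Lemma s1n2 : (w ⊗ sw) ∘ (w ⊗ w ⊗ ng) = (w ⊗ ng ⊗ w) ∘ (w ⊗ sw) :> diag.
Proof. by rewrite -!parA; interchange; rewrite sw_ng1. Qed.

Lemma b0_par2 (x : diag) : ty 1 x ->
  (bs ⊗ w) ∘ (w ⊗ w ⊗ x) = (w ⊗ w ⊗ x) ∘ (bs ⊗ w).
Proof. by move=> hx; rewrite -!idd2 -!idd1 par_comm //; typ. Qed.

Lemma bz_par1 (x : diag) : ty 1 x ->
  bz ∘ (w ⊗ x ⊗ w) = (w ⊗ x ⊗ w) ∘ bz.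
Proof.
move=> hx; rewrite bzE.
have e : (w ⊗ sw) ∘ (w ⊗ x ⊗ w) = (w ⊗ w ⊗ x) ∘ (w ⊗ sw) :> diag.
  by rewrite -!parA; interchange; rewrite sw_par'.
have e' : (w ⊗ sw) ∘ (w ⊗ w ⊗ x) = (w ⊗ x ⊗ w) ∘ (w ⊗ sw) :> diag.
  by rewrite -!parA; interchange; rewrite sw_par.
by rw e; rw (b0_par2 hx); rw e'.
Qed.

Lemma b1_ng1_b1 : (w ⊗ bs) ∘ (w ⊗ ng ⊗ w) ∘ (w ⊗ bs) =
  (w ⊗ ng ⊗ w) ∘ (w ⊗ bs) ∘ (w ⊗ ng ⊗ w) :> diag.
Proof. by rewrite -!parA; interchange; rewrite bs_ng_bs. Qed.

(* The transpositions (V_1 H_2) and (H_0 H_1) commute. *)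
Lemma b0_nbn : (bs ⊗ w) ∘ (w ⊗ ng ⊗ w) ∘ (w ⊗ bs) ∘ (w ⊗ ng ⊗ w) =
  (w ⊗ ng ⊗ w) ∘ (w ⊗ bs) ∘ (w ⊗ ng ⊗ w) ∘ (bs ⊗ w) :> diag.
Proof.
have tb := ty_bz erefl.
have e1 : (w ⊗ bs) ∘ (bs ⊗ w) = bz ∘ (w ⊗ bs) :> diag.
  by rewrite -bz_b1; kill b1b1.
have e2 : (w ⊗ bs) ∘ bz = (bs ⊗ w) ∘ (w ⊗ bs) :> diag.
  by rewrite -bz_b1; kill b1b1.
rw (esym b1_ng1_b1); rw e1.
by rw (esym (bz_par1 (ty_ng R q erefl))); rw e2; rw b1_ng1_b1.
Qed.

End SmallDiagrams2.

Arguments bz {R q}.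
Arguments s02 {R q}.
Arguments ng0_ng1 {R q}.
Arguments ng1_ng0 {R q}.
Arguments ng_ng {R q}.
Arguments ww {R q}.
Arguments idd3 {R q}.
Arguments ngng_ngng {R q}.
Arguments sw_bs_sw {R q}.
Arguments cls_swap1_1 {R q}.
Arguments sw_bs {R q}.
Arguments sw_ng0 {R q}.
Arguments sw_ng1 {R q}.
Arguments bs_ng1_bs {R q}.
Arguments bzE {R q}.
Arguments b0b0 {R q}.
Arguments b1b1 {R q}.
Arguments s0s0 {R q}.
Arguments s1s1 {R q}.
Arguments s0b0 {R q}.
Arguments s1b1 {R q}.
Arguments braid_sw {R q}.
Arguments bz_s0 {R q}.
Arguments bz_b0 {R q}.
Arguments bzbz {R q}.
Arguments s02E {R q}.
Arguments s02s02 {R q}.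
Arguments s02b0 {R q}.
Arguments s02b1 {R q}.
Arguments s02bz {R q}.
Arguments bz_b1 {R q}.
Arguments s1n1 {R q}.
Arguments s1n2 {R q}.
Arguments b1_ng1_b1 {R q}.
Arguments b0_nbn {R q}.

#[export] Hint Extern 0 (ty _ _) =>
  (first [apply: ty_bz | apply: ty_s02]; arith) : tydb.

Arguments trd {R q} x.

(** * Gates acting on one polarisation *)

Section PolarisedGates.
Variables (R : realType) (q : nat).
Notation diag := (diag R q).
Implicit Types (U V X : 'M[R[i]]_q) (x y : diag).

(* [hg U] applies [U] to the polarisation that the beam splitter reflects, called
   H below, and [kg U] applies it to the other one, called V. *)
Definition hg U : diag := locked (trd ((w ⊗ ga U) ∘ bs)).

Lemma hgE U : hg U = trd ((w ⊗ ga U) ∘ bs).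
Proof. by rewrite /hg -lock. Qed.

Lemma ty_hg U n : n = 1 -> ty n (hg U).
Proof. by move=> ->; rewrite hgE; typ. Qed.

Definition kg U : diag := locked (ng ∘ hg U ∘ ng).

Lemma kgE U : kg U = ng ∘ hg U ∘ ng.
Proof. by rewrite /kg -lock. Qed.

Lemma ty_kg U n : n = 1 -> ty n (kg U).
Proof. by move=> ->; rewrite kgE; do 2?apply: ty_seq; try exact: ty_hg; typ. Qed.

Lemma par12 x y : ty 1 x -> ty 1 y -> (x ⊗ w) ∘ (w ⊗ y) = x ⊗ y.
Proof. by move=> hx hy; rewrite -idd1 par_split. Qed.

Lemma par21 x y : ty 1 x -> ty 1 y -> (w ⊗ y) ∘ (x ⊗ w) = x ⊗ y.
Proof. by move=> hx hy; rewrite -idd1 -par_comm ?par_split. Qed.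

Lemma par23 x y : ty 1 x -> ty 1 y -> (w ⊗ x ⊗ w) ∘ (w ⊗ w ⊗ y) = w ⊗ (x ⊗ y).
Proof. by move=> hx hy; rewrite -2!parA (parwr (n := 2)) ?par12; try typ. Qed.

Lemma swap_par x y : ty 1 x -> ty 1 y -> sw ∘ (x ⊗ y) = (y ⊗ x) ∘ sw.
Proof.
by move=> hx hy; rewrite -par12 // -(par21 hy hx); rw (sw_par' hx); rw (sw_par hy).
Qed.

Lemma par3_comm x y : ty 2 x -> ty 1 y ->
  (x ⊗ w) ∘ (w ⊗ w ⊗ y) = (w ⊗ w ⊗ y) ∘ (x ⊗ w).
Proof. by move=> hx hy; rewrite -idd2 -idd1 par_comm. Qed.

Lemma w_hg U : w ⊗ hg U = trd ((w ⊗ w ⊗ ga U) ∘ (w ⊗ bs)).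
Proof.
rewrite hgE -(tr_super (n := 1) (m := 1)); try typ.
by rewrite -(parwr (n := 2)) ?parA; try typ.
Qed.

Lemma hg_w U : hg U ⊗ w = trd ((w ⊗ w ⊗ ga U) ∘ bz).
Proof.
have th : ty 1 (hg U) by exact: ty_hg.
have -> : hg U ⊗ w = sw ∘ (w ⊗ hg U) ∘ sw by rewrite sw_par //; kill sw_sw.
rewrite w_hg -(tr_out (n := 2)) -?(tr_in (n := 2)); try typ.
by rewrite !seqA par3_comm; try typ; rw bz_s0.
Qed.

(** Written as loops on three wires, the two gates differ by conjugation with [bs ⊗ w], which by
    [bz_b0] exchanges [bz] and [w ⊗ bs]. *)
Lemma bs_hg0 U : bs ∘ (hg U ⊗ w) = (w ⊗ hg U) ∘ bs.
Proof.
rewrite hg_w w_hg -(tr_out (n := 2)) -?(tr_in (n := 2)); try typ.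
by rewrite !seqA par3_comm -?bz_b0; try typ; kill b0b0.
Qed.

Lemma bs_hg1 U : bs ∘ (w ⊗ hg U) = (hg U ⊗ w) ∘ bs.
Proof.
have th : ty 1 (hg U) by exact: ty_hg.
transitivity (bs ∘ ((w ⊗ hg U) ∘ bs) ∘ bs); first by kill bs_bs.
by rewrite -bs_hg0; kill bs_bs.
Qed.

Lemma hg_loop U V : hg U = trd ((w ⊗ ga V) ∘ bs ∘ (w ⊗ ga U) ∘ bs).
Proof. by rewrite tr_loop hgE. Qed.

(* [hg U] placed inside a loop is as good as the plain gate [ga U]: with the
   help of axiom (4) the inner loop is surrounded by two beam splitters, one of
   which slides around both loops. *)
Lemma hg_nested X U : trd ((w ⊗ (ga X ∘ hg U)) ∘ bs) = hg (X *m U).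
Proof.
have th : ty 1 (hg U) by exact: ty_hg.
have th' : ty 1 (hg (X *m U)) by exact: ty_hg.
rewrite -(parwr (n := 1)); try typ.
have -> : w ⊗ hg U = trd ((w ⊗ w ⊗ ga X) ∘ (w ⊗ bs) ∘ (w ⊗ w ⊗ ga U) ∘ (w ⊗ bs)).
  (* The free gate of [hg_loop] is taken to be [X], so that both looped wires carry [X] and a beam
     splitter passes them by [bs_ga]. *)
  rewrite (hg_loop U X) -(tr_super (n := 1) (m := 1)); try typ.
  by rewrite -!(parwr (n := 2)) ?parA; try typ.
rewrite -(tr_out (n := 2)) -?(tr_in (n := 2)); try typ.
have e : (w ⊗ bs) ∘ (w ⊗ ga X ⊗ w) ∘ (w ⊗ w ⊗ ga X) =
    (w ⊗ ga X ⊗ w) ∘ (w ⊗ w ⊗ ga X) ∘ (w ⊗ bs) :> diag.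
  by rewrite -[LHS]seqA par23 ?(parwr (n := 2)) ?bs_ga; try typ.
transitivity (trd (trd ((w ⊗ bs) ∘ ((w ⊗ ga X ⊗ w) ∘ (w ⊗ w ⊗ ga X) ∘
    (w ⊗ w ⊗ ga U) ∘ (w ⊗ bs) ∘ (bs ⊗ w))))).
  by congr (trd (trd _)); rewrite !seqA; rw e.
rewrite -{1}idd1 tr_slide2 ?idd1; try typ.
have -> : (w ⊗ ga X ⊗ w) ∘ (w ⊗ w ⊗ ga X) ∘ (w ⊗ w ⊗ ga U) ∘ (w ⊗ bs) ∘
    (bs ⊗ w) ∘ (w ⊗ bs) =
    (w ⊗ ga X ⊗ w) ∘ ((w ⊗ w ⊗ ga (X *m U)) ∘ bz).
  rw bz_b1; congr (_ ∘ _).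
  by rewrite -seqA; congr (_ ∘ _); interchange; rewrite ga_mul !ww.
rewrite (tr_out (n := 2)); try typ.
by rewrite -hg_w par21; try typ; rewrite (tr_super (n := 1) (m := 0)) ?tr_ga ?par_eps; try typ.
Qed.

(** [bs_hg0] moves [hg U] from the input into the loop of [hg V], where [hg_nested] absorbs it. *)
Lemma hg_mul V U : hg V ∘ hg U = hg (V *m U).
Proof.
have th : ty 1 (hg U) by exact: ty_hg.
rewrite [hg V]hgE -(tr_in (n := 1)); try typ.
by rewrite -[_ ∘ bs ∘ _]seqA bs_hg0 seqA (parwr (n := 1)) ?hg_nested; try typ.
Qed.

(** [tr_loop] at identity matrices: one of its sides then contains [bs ∘ bs], two plain wires. *)
Lemma tr_bs : trd bs = w :> diag.
Proof.
have e := tr_loop (1%:M : 'M[R[i]]_q) 1%:M.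
rewrite !ga1 -!idd2 !seq1d ?seqd1 in e; try typ.
rewrite -e bs_bs idd2 (tr_super (n := 1) (m := 0)); try typ.
by rewrite -ga1 tr_ga par_eps.
Qed.

Lemma hg1 : hg 1%:M = w.
Proof. by rewrite hgE ga1 -idd2 seq1d ?tr_bs; try typ. Qed.

Lemma ngK : ng ∘ ng = idd 1 :> diag.
Proof. by rewrite ng_ng idd1. Qed.

Lemma kg_mul V U : kg V ∘ kg U = kg (V *m U).
Proof.
have t U' : ty 1 (hg U') by exact: ty_hg.
rewrite !kgE -hg_mul; have tv := t V; have tu := t U.
by kill ngK.
Qed.

Lemma kg1 : kg 1%:M = w.
Proof. by rewrite kgE hg1 -idd1; rewrite seqd1 ?ngK; try typ. Qed.

Lemma hg_ng U : hg U ∘ ng = ng ∘ kg U.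
Proof.
have th : ty 1 (hg U) by exact: ty_hg.
by rewrite kgE; kill ngK.
Qed.

Lemma ng_hg U : ng ∘ hg U = kg U ∘ ng.
Proof.
have th : ty 1 (hg U) by exact: ty_hg.
by rewrite kgE; kill ngK.
Qed.

Lemma ng2_g2 U : (w ⊗ w ⊗ ng) ∘ (w ⊗ w ⊗ ga U) = (w ⊗ w ⊗ ga U) ∘ (w ⊗ w ⊗ ng) :> diag.
Proof. by interchange; rewrite ga_ng. Qed.

Lemma ng1_g2 U : (w ⊗ ng ⊗ w) ∘ (w ⊗ w ⊗ ga U) = (w ⊗ w ⊗ ga U) ∘ (w ⊗ ng ⊗ w) :> diag.
Proof. by apply: par3_comm; typ. Qed.

Lemma ng0_g2 U : (ng ⊗ w ⊗ w) ∘ (w ⊗ w ⊗ ga U) = (w ⊗ w ⊗ ga U) ∘ (ng ⊗ w ⊗ w) :> diag.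
Proof. by apply: par3_comm; typ. Qed.

Lemma w_kg U : w ⊗ kg U =
  trd ((w ⊗ w ⊗ ga U) ∘ ((w ⊗ ng ⊗ w) ∘ (w ⊗ bs) ∘ (w ⊗ ng ⊗ w))).
Proof.
have th : ty 1 (hg U) by exact: ty_hg.
rewrite kgE -!(parwr (n := 1)); try typ.
rewrite w_hg -(tr_out (n := 2)) -?(tr_in (n := 2)); try typ.
by rewrite !seqA ng1_g2.
Qed.

Lemma kg_w U : kg U ⊗ w =
  trd ((w ⊗ w ⊗ ga U) ∘ ((ng ⊗ w ⊗ w) ∘ bz ∘ (ng ⊗ w ⊗ w))).
Proof.
have th : ty 1 (hg U) by exact: ty_hg.
rewrite kgE -!(parwl (n := 1)); try typ.
rewrite hg_w -(tr_out (n := 2)) -?(tr_in (n := 2)); try typ.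
by rewrite !seqA ng0_g2.
Qed.

(** The loop of [w ⊗ kg U] is made with the transposition (V_1 H_2), which commutes with (H_0 H_1)
    by [b0_nbn]. *)
Lemma bs_kg1 U : bs ∘ (w ⊗ kg U) = (w ⊗ kg U) ∘ bs.
Proof.
rewrite w_kg -(tr_out (n := 2)) -?(tr_in (n := 2)); try typ.
congr trd; rewrite !seqA par3_comm; try typ.
by rw b0_nbn.
Qed.

Lemma bs_kg0 U : bs ∘ (kg U ⊗ w) = (kg U ⊗ w) ∘ bs.
Proof.
have tk : ty 1 (kg U) by exact: ty_kg.
transitivity (sw ∘ (bs ∘ (w ⊗ kg U)) ∘ sw).
  by rw sw_bs; rw (sw_par tk); kill sw_sw.
by rewrite bs_kg1; rw (sw_par tk); rw sw_bs; kill sw_sw.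
Qed.

Lemma hg_kg U V : hg U ∘ kg V = kg V ∘ hg U.
Proof.
have tk : ty 1 (kg V) by exact: ty_kg.
rewrite hgE -(tr_in (n := 1)) -?(tr_out (n := 1)); try typ.
rewrite -[_ ∘ bs ∘ _]seqA bs_kg0 !seqA par12 ?par21 //; typ.
Qed.

(** [ng_bs_ng] transported from the first two wires to the first and the third. *)
Lemma n02_bz : (ng ⊗ w ⊗ w) ∘ (w ⊗ w ⊗ ng) ∘ bz ∘ (ng ⊗ w ⊗ w) ∘ (w ⊗ w ⊗ ng) =
  s02 ∘ bz :> diag.
Proof.
have e : (w ⊗ sw) ∘ (ng ⊗ w ⊗ w) = (ng ⊗ w ⊗ w) ∘ (w ⊗ sw) :> diag.
  by rewrite -!parA -idd2 -idd1 par_comm //; typ.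
have e' : (w ⊗ sw) ∘ (w ⊗ w ⊗ ng) = (w ⊗ ng ⊗ w) ∘ (w ⊗ sw) :> diag := s1n2.
have f : (ng ⊗ w ⊗ w) ∘ (w ⊗ ng ⊗ w) ∘ (bs ⊗ w) ∘ (ng ⊗ w ⊗ w) ∘ (w ⊗ ng ⊗ w) =
   (sw ⊗ w) ∘ (bs ⊗ w) :> diag.
  rewrite !(parwl (n := 2)); try typ.
  by rewrite ng0_ng1 -seqA ng0_ng1 ng_bs_ng.
transitivity ((w ⊗ sw) ∘ ((ng ⊗ w ⊗ w) ∘ (w ⊗ ng ⊗ w) ∘ (bs ⊗ w) ∘
    (ng ⊗ w ⊗ w) ∘ (w ⊗ ng ⊗ w)) ∘ (w ⊗ sw) : diag); last first.
  by rewrite f bzE s02E; kill s1s1.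
by rw e; rw s1n1; rewrite bzE; rw e; rw (esym s1n2).
Qed.

(* The two loops of [hg U] and [kg U] together carry both polarisations, like
   the wires of a swap. *)
Lemma hg_kg_ga U : hg U ∘ kg U = ga U.
Proof.
have tk : ty 1 (kg U) by exact: ty_kg.
rewrite {1}hgE -(tr_in (n := 1)); try typ.
rewrite kg_w -(tr_out (n := 2)); try typ.
pose G : diag := w ⊗ (ga U ⊗ ga U).
have tG : ty 3 G by rewrite /G; typ.
have GE : (w ⊗ ga U ⊗ w) ∘ (w ⊗ w ⊗ ga U) = G by rewrite par23; try typ.
have n2G : (w ⊗ w ⊗ ng) ∘ G = G ∘ (w ⊗ w ⊗ ng).
  have e : (w ⊗ w ⊗ ng) ∘ (w ⊗ ga U ⊗ w) = (w ⊗ ga U ⊗ w) ∘ (w ⊗ w ⊗ ng) :> diag.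
    by rewrite par3_comm; try typ.
  by rewrite -GE; rw e; rw (ng2_g2 U).
have b1G : (w ⊗ bs) ∘ G = G ∘ (w ⊗ bs) by rewrite !(parwr (n := 2)) ?bs_ga; try typ.
have s1G : (w ⊗ sw) ∘ G = G ∘ (w ⊗ sw).
  by rewrite !(parwr (n := 2)) ?swap_par; try typ.
transitivity (trd (trd (G ∘ ((bs ⊗ w) ∘ (ng ⊗ w ⊗ w) ∘ bz ∘ (ng ⊗ w ⊗ w))))).
  have e : (bs ⊗ w) ∘ (w ⊗ w ⊗ ga U) = (w ⊗ w ⊗ ga U) ∘ (bs ⊗ w) :> diag.
    by rewrite par3_comm; try typ.
  by rewrite -GE -(parwl (n := 2)); try typ; congr (trd (trd _)); rw e.
(* What commutes with [G] can be slid around the loops to conjugate the rest. A negation turns the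
   conjugated [bz] into [s02 ∘ bz], a beam splitter between the looped wires erases both beam
   splitters, and a swap of these wires reduces [s02] to [sw ⊗ w]. *)
have slide2 x : ty 3 x -> trd (trd ((w ⊗ w ⊗ ng) ∘ x)) = trd (trd (x ∘ (w ⊗ w ⊗ ng))).
  by move=> hx; rewrite -idd2 tr_slide1; try typ.
have slideb x : ty 3 x -> trd (trd ((w ⊗ bs) ∘ x)) = trd (trd (x ∘ (w ⊗ bs))).
  by move=> hx; rewrite -idd1 tr_slide2; try typ.
have slides x : ty 3 x -> trd (trd ((w ⊗ sw) ∘ x)) = trd (trd (x ∘ (w ⊗ sw))).
  by move=> hx; rewrite -idd1 tr_slide2; try typ.
have n2n2 : (w ⊗ w ⊗ ng) ∘ (w ⊗ w ⊗ ng) = idd 3 :> diag.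
  by interchange; rewrite ng_ng !ww idd3.
transitivity (trd (trd (G ∘ ((bs ⊗ w) ∘ (s02 ∘ bz))))).
  rewrite -n02_bz.
  set x := LHS; transitivity (trd (trd ((w ⊗ w ⊗ ng) ∘ ((w ⊗ w ⊗ ng) ∘
    (G ∘ ((bs ⊗ w) ∘ (ng ⊗ w ⊗ w) ∘ bz ∘ (ng ⊗ w ⊗ w))))))).
    by rewrite /x !seqA n2n2 seq1d; try typ.
  rewrite slide2; try typ; congr (trd (trd _)).
  have e : (w ⊗ w ⊗ ng) ∘ (bs ⊗ w) = (bs ⊗ w) ∘ (w ⊗ w ⊗ ng) :> diag.
    by rewrite par3_comm; try typ.
  have f : (w ⊗ w ⊗ ng) ∘ (ng ⊗ w ⊗ w) = (ng ⊗ w ⊗ w) ∘ (w ⊗ w ⊗ ng) :> diag.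
    by rewrite par3_comm; try typ.
  by rw n2G; rw e; rw f.
have e : (w ⊗ bs) ∘ (bs ⊗ w) ∘ s02 ∘ bz ∘ (w ⊗ bs) = s02 :> diag.
  rewrite -{1}bz_b0; rw s02b0; rw s02b1; rw s02b0; rw s02b1; rw bz_b1; rw bz_b0.
  by kill bzbz.
transitivity (trd (trd (G ∘ s02))).
  rewrite -[in RHS]e; set x := LHS.
  transitivity (trd (trd ((w ⊗ bs) ∘ ((w ⊗ bs) ∘ (G ∘ ((bs ⊗ w) ∘ (s02 ∘ bz))))))).
    by rewrite /x !seqA b1b1 seq1d; try typ.
  by rewrite slideb; try typ; congr (trd (trd _)); rw b1G.
rewrite s02E; transitivity (trd (trd (G ∘ (sw ⊗ w)))).
  rewrite !seqA -slides; try typ; congr (trd (trd _)).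
  by rw s1G; kill s1s1.
have -> : G ∘ (sw ⊗ w) = ((w ⊗ ga U) ∘ sw) ⊗ ga U.
  rewrite /G parA -(par_seq (n := 2) (m := 1)); try typ.
  by rewrite -[X in _ ⊗ (_ ∘ X)]idd1 seqd1; try typ.
rewrite (tr_super (n := 2) (m := 0)) ?tr_ga ?par_eps; try typ.
by rewrite -sw_par' ?(tr_in (n := 1)) ?tr_sw -?idd1 ?seq1d; try typ.
Qed.

End PolarisedGates.

Arguments ng2_g2 {R q} U.
Arguments ngK {R q}.
Arguments tr_bs {R q}.
Arguments hg1 {R q}.
Arguments kg1 {R q}.
Arguments n02_bz {R q}.

#[export] Hint Extern 0 (ty _ _) =>
  (first [apply: ty_hg | apply: ty_kg]; arith) : tydb.

(** * Traces of diagrams on one and two wires with polarised gates *)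

Section Traces.
Variables (R : realType) (q : nat).
Notation diag := (diag R q).
Implicit Types (U V X Y S : 'M[R[i]]_q) (x y : diag).

Lemma tr_rot1 x y : ty 1 x -> ty 1 y -> trd (x ∘ y) = trd (y ∘ x).
Proof.
move=> hx hy; have := tr_slide1 (n := 0) hy hx.
by rewrite idd0 !eps_par.
Qed.

Lemma tr_rot2 x y : ty 2 x -> ty 2 y -> trd (trd (x ∘ y)) = trd (trd (y ∘ x)).
Proof.
move=> hx hy; have := tr_slide2 (n := 0) hy hx.
by rewrite idd0 !eps_par.
Qed.

Lemma tr_rotw x y : ty 2 x -> ty 1 y -> trd (x ∘ (w ⊗ y)) = trd ((w ⊗ y) ∘ x).
Proof. by move=> hx hy; rewrite -idd1 tr_slide1. Qed.

Lemma tr_rotw2 x y : ty 3 x -> ty 2 y ->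
  trd (trd (x ∘ (w ⊗ y))) = trd (trd ((w ⊗ y) ∘ x)).
Proof. by move=> hx hy; rewrite -idd1 tr_slide2. Qed.

(** [hg_loop] puts [ga X] on the second wire too, so the two copies pass a beam splitter. With both
    wires closed, this beam splitter rotates around and cancels the other one, leaving two loops of
    plain gates. *)
Lemma tr_ga_hg X Y : trd (ga X ∘ hg Y) = epsd.
Proof.
rewrite (hg_loop Y X) -(tr_out (n := 1)); try typ.
have e : (ga X ⊗ w) ∘ (w ⊗ ga X) ∘ bs = bs ∘ (ga X ⊗ w) ∘ (w ⊗ ga X) :> diag.
  by rewrite -[RHS]seqA par12 ?bs_ga; try typ.
transitivity (trd (trd (bs ∘ ((ga X ⊗ w) ∘ (w ⊗ ga X) ∘ (w ⊗ ga Y) ∘ bs)))).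
  by congr (trd (trd _)); rw e.
rewrite tr_rot2; try typ; kill bs_bs.
rewrite -[_ ∘ (w ⊗ ga Y)]seqA (parwr (n := 1)) ?par12 ?ga_mul; try typ.
by rewrite (tr_super (n := 1) (m := 0)) ?tr_ga ?par_eps; try typ; exact: tr_ga.
Qed.

Lemma tr_kg_hg U V : U \in unitmx -> trd (kg U ∘ hg V) = epsd.
Proof.
move=> hU; rewrite -(tr_ga_hg U (invmx U *m V)) -hg_kg_ga.
rewrite hg_kg -seqA hg_mul mulmxA mulmxV // mul1mx //.
Qed.

(** A second loop carrying [ga S] is worth [epsd] and makes room: the transposition (V_0 H_0) is
    conjugate to (H_0 H_1) by a diagram commuting with [ga S ⊗ ga S], so cyclicity replaces the
    negation by [bs]. *)
Lemma tr_ng_ga S : trd (ng ∘ ga S) = epsd.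
Proof.
have e : trd (ng ∘ ga S) = trd (trd ((ng ⊗ w) ∘ (ga S ⊗ ga S))).
  rewrite -(par_seq (n := 1) (m := 1)) 1?(tr_super (n := 1) (m := 0)); try typ.
  by rewrite -idd1 seq1d ?tr_ga ?par_eps; try typ.
have nG : (ng ⊗ w) ∘ (ga S ⊗ ga S) = (ga S ⊗ ga S) ∘ (ng ⊗ w).
  by interchange; rewrite ga_ng -idd1 seq1d ?seqd1; try typ.
have n0n0 : (ng ⊗ w) ∘ (ng ⊗ w) = idd 2 :> diag by rewrite (parwl (n := 1)) ?ngK -?iddS; try typ.
have nE : ng ⊗ w = bs ∘ (ng ⊗ w) ∘ bs ∘ (ng ⊗ w) ∘ bs :> diag.
  by rw bs_ng_bs; kill n0n0; kill bs_bs.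
transitivity (trd (trd ((bs ∘ (ng ⊗ w)) ∘ (bs ∘ (ng ⊗ w) ∘ bs ∘ (ga S ⊗ ga S))))).
  by rewrite e {1}nE !seqA.
rewrite tr_rot2; try typ.
rewrite -[_ ∘ bs ∘ (ga S ⊗ ga S)]seqA bs_ga.
have -> : bs ∘ (ng ⊗ w) ∘ ((ga S ⊗ ga S) ∘ bs) ∘ (bs ∘ (ng ⊗ w)) =
    (ga S ⊗ ga S) ∘ bs.
  by kill bs_bs; rw nG; kill n0n0; exact: bs_ga.
by rewrite -par12 ?(tr_out (n := 1)) -?seqA ?(tr_out (n := 1)) -?hgE ?tr_ga_hg; try typ.
Qed.

(** The negation joins both polarisations into one loop with total gate [V *m U]. Redistributed as
    [S] on each polarisation, it is the plain gate [ga S]. *)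
Lemma tr_ng_kg_hg U V S : S *m S = V *m U -> trd (ng ∘ (kg U ∘ hg V)) = epsd.
Proof.
move=> hS; rewrite seqA -hg_ng -seqA tr_rot1; try typ.
rewrite -seqA hg_mul -hS -hg_mul seqA tr_rot1; try typ.
by rewrite seqA hg_ng -seqA -hg_kg hg_kg_ga tr_ng_ga.
Qed.

(** [kg V] is [ga V ∘ hg (invmx V)], and [hg_nested] multiplies the two factors to the identity. *)
Lemma tr_bs_kg V : V \in unitmx -> trd (bs ∘ (w ⊗ kg V)) = w.
Proof.
move=> hV; rewrite bs_kg1.
have -> : kg V = ga V ∘ hg (invmx V).
  rewrite -hg_kg_ga hg_kg -seqA hg_mul mulmxV // hg1.
  by rewrite -idd1 seqd1; try typ.
by rewrite hg_nested mulmxV // hg1.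
Qed.

(* Exchanges the modes H_0 and V_1. *)
Definition xs : diag := locked ((w ⊗ ng) ∘ bs ∘ (w ⊗ ng)).

Lemma xsE : xs = (w ⊗ ng) ∘ bs ∘ (w ⊗ ng).
Proof. by rewrite /xs -lock. Qed.

Lemma ty_xs n : n = 2 -> ty n xs.
Proof. by move=> ->; rewrite xsE; typ. Qed.

Lemma ng0ng0 : (ng ⊗ w) ∘ (ng ⊗ w) = idd 2 :> diag.
Proof. by rewrite (parwl (n := 1)) ?ngK -?iddS; try typ. Qed.

Lemma ng1ng1 : (w ⊗ ng) ∘ (w ⊗ ng) = idd 2 :> diag.
Proof. by rewrite (parwr (n := 1)) ?ng_ng -?idd2; try typ. Qed.

Lemma xs_xs : xs ∘ xs = idd 2.
Proof. by rewrite !xsE; kill ng1ng1; kill bs_bs; rewrite ng1ng1. Qed.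

Lemma ng1_ng0_ng1 : (w ⊗ ng) ∘ (ng ⊗ w) ∘ (w ⊗ ng) = ng ⊗ w :> diag.
Proof. by rewrite ng1_ng0 -ng0_ng1; kill ng1ng1. Qed.

Lemma ng0_xs_ng0 : (ng ⊗ w) ∘ xs ∘ (ng ⊗ w) = xs ∘ (ng ⊗ w) ∘ xs.
Proof.
rewrite !xsE; rw ng0_ng1; rw ng1_ng0; rw ng1_ng0_ng1; rw bs_ng_bs.
by rw ng1_ng0; rw ng0_ng1.
Qed.

Lemma ng1_xs_ng1 : (w ⊗ ng) ∘ xs ∘ (w ⊗ ng) = bs.
Proof. by rewrite !xsE; kill ng1ng1; kill ng1ng1. Qed.

Lemma xs_ng1_xs : xs ∘ (w ⊗ ng) ∘ xs = bs.
Proof. by rewrite !xsE; kill ng1ng1; rw bs_ng1_bs; kill ng1ng1; kill ng1ng1. Qed.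

Lemma xs_w : xs ⊗ w = (w ⊗ ng ⊗ w) ∘ (bs ⊗ w) ∘ (w ⊗ ng ⊗ w).
Proof. by rewrite xsE -!(parwl (n := 2)); try typ. Qed.

Lemma w_xs : w ⊗ xs = (w ⊗ w ⊗ ng) ∘ (w ⊗ bs) ∘ (w ⊗ w ⊗ ng).
Proof. by rewrite xsE -!(parwr (n := 2)) -?parA; try typ. Qed.

Lemma xs_xs_comm : (xs ⊗ w) ∘ (w ⊗ xs) = (w ⊗ xs) ∘ (xs ⊗ w).
Proof.
have tx : ty 2 xs by exact: ty_xs.
have nn : (w ⊗ ng ⊗ w) ∘ (w ⊗ ng ⊗ w) = idd 3 :> diag.
  by rewrite (parwl (n := 2)) ?ng1ng1 -?iddS; try typ.
have c1 : (w ⊗ bs) ∘ (xs ⊗ w) = (xs ⊗ w) ∘ (w ⊗ bs).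
  transitivity ((w ⊗ ng ⊗ w) ∘ ((w ⊗ ng ⊗ w) ∘ (w ⊗ bs) ∘ (w ⊗ ng ⊗ w) ∘ (bs ⊗ w))
      ∘ (w ⊗ ng ⊗ w) : diag).
    by rewrite xs_w; kill nn.
  by rewrite -b0_nbn xs_w; kill nn.
have c2 : (w ⊗ w ⊗ ng) ∘ (xs ⊗ w) = (xs ⊗ w) ∘ (w ⊗ w ⊗ ng).
  by rewrite par3_comm; try typ.
by rewrite w_xs; rw (esym c2); rw (esym c1); rw (esym c2).
Qed.

(** The permutation (V_0 V_1)(H_0 H_1), obtained by conjugating (V_0 H_0)(V_1 H_1) with (H_0
    V_1). *)
Lemma xs_sw : xs ∘ (w ⊗ ng) ∘ (ng ⊗ w) ∘ xs = sw.
Proof.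
have bNb : bs ∘ (ng ⊗ ng) ∘ bs = (ng ⊗ ng) ∘ sw :> diag.
  transitivity ((ng ⊗ ng) ∘ ((ng ⊗ ng) ∘ bs ∘ (ng ⊗ ng)) ∘ bs : diag).
    by kill ngng_ngng.
  by rewrite ng_bs_ng; kill bs_bs.
rewrite !xsE; kill ng1ng1; rw ng0_ng1; rw bNb; rw sw_ng1.
by rewrite -ng1_ng0; kill ng1ng1; kill ng0ng0.
Qed.

Lemma ng1_hg1 U : (w ⊗ ng) ∘ (w ⊗ hg U) = (w ⊗ kg U) ∘ (w ⊗ ng).
Proof. by rewrite !(parwr (n := 1)) ?ng_hg; try typ. Qed.

Lemma ng1_kg1 U : (w ⊗ ng) ∘ (w ⊗ kg U) = (w ⊗ hg U) ∘ (w ⊗ ng).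
Proof. by rewrite !(parwr (n := 1)) -?hg_ng; try typ. Qed.

Lemma par2_comm x y : ty 1 x -> ty 1 y -> (w ⊗ y) ∘ (x ⊗ w) = (x ⊗ w) ∘ (w ⊗ y).
Proof. by move=> hx hy; rewrite par12 ?par21. Qed.

Lemma xs_hg0 U : xs ∘ (hg U ⊗ w) = (w ⊗ kg U) ∘ xs.
Proof.
have th : ty 1 (hg U) by typ. have tn := ty_ng R q erefl.
by rewrite xsE; rw (par2_comm th tn); rw (bs_hg0 U); rw (ng1_hg1 U).
Qed.

Lemma xs_hg1 U : xs ∘ (w ⊗ hg U) = (w ⊗ hg U) ∘ xs.
Proof. by rewrite xsE; rw (ng1_hg1 U); rw (bs_kg1 U); rw (ng1_kg1 U). Qed.

Lemma xs_kg0 U : xs ∘ (kg U ⊗ w) = (kg U ⊗ w) ∘ xs.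
Proof.
have tk : ty 1 (kg U) by typ. have tn := ty_ng R q erefl.
by rewrite xsE; rw (par2_comm tk tn); rw (bs_kg0 U); rw (par2_comm tk tn).
Qed.

Lemma seqdw x : ty 1 x -> x ∘ w = x.
Proof. by move=> hx; rewrite -idd1 seqd1. Qed.

Lemma ng_kg_hg_ng U V : ng ∘ (kg U ∘ hg V) ∘ ng = hg U ∘ kg V.
Proof.
by rewrite seqA -hg_ng -!seqA hg_ng; kill ngK.
Qed.

(** A particle entering in H_0 makes one turn of the loop as V_1, meets [U] and leaves in H_0. The
    mode H_1 only circulates, and its gate [V] disappears by [tr_bs_kg]. The traces with [bs] below
    can be read in the same way. *)
Lemma tr_xs U V : V \in unitmx -> trd (xs ∘ (w ⊗ (kg U ∘ hg V))) = hg U.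
Proof.
move=> hV; have tn := ty_ng R q erefl.
transitivity (trd ((w ⊗ ng) ∘ (bs ∘ (w ⊗ ng) ∘ (w ⊗ (kg U ∘ hg V))))).
  by rewrite xsE !seqA.
rewrite -tr_rotw; try typ.
transitivity (trd ((hg U ⊗ w) ∘ (bs ∘ (w ⊗ kg V)))).
  by congr trd; rewrite seqA -bs_hg1 -!seqA !(parwr (n := 1)) -?ng_kg_hg_ng ?seqA; try typ.
by rewrite (tr_out (n := 1)) ?tr_bs_kg ?seqdw; try typ.
Qed.

(** With one more empty loop, [g] is the transposition (V_1 H_2). It commutes with [bs ⊗ w] and
    conjugates the negation (V_1 H_1) into [w ⊗ bs], after which each loop is the trace of a beam
    splitter. *)
Lemma tr_bs_ng : trd (bs ∘ (w ⊗ ng)) = w :> diag.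
Proof.
have nn : (w ⊗ ng ⊗ w) ∘ (w ⊗ ng ⊗ w) = idd 3 :> diag.
  by rewrite (parwl (n := 2)) ?ng1ng1 -?iddS; try typ.
pose g : diag := w ⊗ ((ng ⊗ w) ∘ bs ∘ (ng ⊗ w)).
have gE : g = (w ⊗ ng ⊗ w) ∘ (w ⊗ bs) ∘ (w ⊗ ng ⊗ w).
  by rewrite /g -!(parwr (n := 2)) ?parA; try typ.
have gg : g ∘ g = idd 3 by rewrite gE; kill nn; kill b1b1; rewrite nn.
have gng : g ∘ (w ⊗ ng ⊗ w) ∘ g = w ⊗ bs.
  by rewrite gE; kill nn; rw b1_ng1_b1; kill nn; kill nn.
have b0g : (bs ⊗ w) ∘ g = g ∘ (bs ⊗ w) by rewrite gE; rw b0_nbn.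
have tg : ty 3 g by rewrite /g; typ.
transitivity (trd (trd ((bs ∘ (w ⊗ ng)) ⊗ w : diag))).
  rewrite (tr_super (n := 2) (m := 0)); try typ.
  by rewrite -ga1 tr_ga par_eps ga1.
transitivity (trd (trd (g ∘ (g ∘ ((bs ⊗ w) ∘ (w ⊗ ng ⊗ w)))))).
  by rewrite !seqA gg seq1d ?(parwl (n := 2)); try typ.
rewrite -tr_rotw2 -/g; try typ.
have -> : g ∘ ((bs ⊗ w) ∘ (w ⊗ ng ⊗ w)) ∘ g = (bs ⊗ w) ∘ (w ⊗ bs).
  by rw (esym b0g); rw gng.
rewrite (tr_out (n := 2)); try typ.
by rewrite (tr_super (n := 1) (m := 1)) ?tr_bs -?idd2 ?seqd1; try typ; exact: tr_bs.
Qed.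

Lemma tr_bs_kg_hg U V : U \in unitmx -> trd (bs ∘ (w ⊗ (kg U ∘ hg V))) = hg V.
Proof.
move=> hU; rewrite -hg_kg -(parwr (n := 1)) ?seqA ?bs_hg1 -?seqA; try typ.
by rewrite (tr_out (n := 1)) ?tr_bs_kg ?seqdw; try typ.
Qed.

Lemma tr_bs_ng_kg_hg U V :
  trd (bs ∘ (w ⊗ ng) ∘ (w ⊗ (kg U ∘ hg V))) = hg (U *m V).
Proof.
have e X : trd (bs ∘ (w ⊗ (hg X ∘ ng))) = hg X.
  rewrite -(parwr (n := 1)) ?seqA ?bs_hg1 -?seqA; try typ.
  by rewrite (tr_out (n := 1)) ?tr_bs_ng ?seqdw; try typ.
have -> : bs ∘ (w ⊗ ng) ∘ (w ⊗ (kg U ∘ hg V)) =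
    (hg U ⊗ w) ∘ ((w ⊗ kg V) ∘ (bs ∘ (w ⊗ ng))).
  rewrite -(parwr (n := 1)); try typ.
  by rw (ng1_kg1 U); rw (bs_hg1 U); rw (ng1_hg1 V); rw (bs_kg1 V).
rewrite (tr_out (n := 1)) -?tr_rotw; try typ.
by rewrite -seqA (parwr (n := 1)) -?hg_ng ?e ?hg_mul; try typ.
Qed.

Lemma tr_ng_bs_kg_hg U V :
  trd ((w ⊗ ng) ∘ bs ∘ (w ⊗ (kg U ∘ hg V))) = hg (V *m U).
Proof.
rewrite -seqA -tr_rotw; try typ.
rewrite -tr_bs_ng_kg_hg -!seqA !(parwr (n := 1)); try typ.
by rewrite -seqA hg_ng seqA -ng_hg -seqA hg_kg.
Qed.

Lemma tr_sw_par x : ty 1 x -> trd (sw ∘ (w ⊗ x)) = x.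
Proof.
move=> hx; rewrite sw_par // (tr_out (n := 1)) ?tr_sw ?seqdw //; typ.
Qed.

End Traces.

Arguments xs {R q}.
Arguments xs_xs {R q}.
Arguments ng0_xs_ng0 {R q}.
Arguments ng1_xs_ng1 {R q}.
Arguments xs_ng1_xs {R q}.
Arguments xs_xs_comm {R q}.
Arguments xs_sw {R q}.
Arguments ng0ng0 {R q}.
Arguments ng1ng1 {R q}.

#[export] Hint Extern 0 (ty _ _) =>
  (first [apply: ty_xs]; arith) : tydb.

(** * Coxeter generators of the symmetric group on the modes *)

Section Coxeter.
Variables (R : realType) (q : nat).
Notation diag := (diag R q).
Implicit Types (U V X Y S : 'M[R[i]]_q) (x y : diag) (n i j k l : nat).

Definition whisker i x j : diag := locked (idd i ⊗ x ⊗ idd j).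

Lemma whiskerE i x j : whisker i x j = idd i ⊗ x ⊗ idd j.
Proof. by rewrite /whisker -lock. Qed.

Lemma ty_whisker n k i x j : ty k x -> n = (i + k + j)%N -> ty n (whisker i x j).
Proof. by move=> hx ->; rewrite whiskerE; typ. Qed.

Lemma whisker_seq k i j x y : ty k x -> ty k y ->
  whisker i x j ∘ whisker i y j = whisker i (x ∘ y) j.
Proof.
move=> hx hy; rewrite !whiskerE -(par_seq (n := (i + k)%N) (m := j)); try typ.
rewrite -(par_seq (n := i) (m := k)); try typ.
by rewrite !(seq1d (k := i)) ?(seq1d (k := j)); try typ.
Qed.

Lemma whisker_idd i j k : whisker i (idd k) j = idd (i + k + j).
Proof. by rewrite whiskerE !idd_add. Qed.

Lemma whisker_l i j x : whisker i.+1 x j = whisker i (w ⊗ x) j.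
Proof. by rewrite !whiskerE iddS parA. Qed.

Lemma whisker_r i j x : whisker i x j.+1 = whisker i (x ⊗ w) j.
Proof. by rewrite !whiskerE -add1n idd_add idd1 !parA. Qed.

Lemma whisker_comm n i x k a i' y l b : ty k x -> ty l y -> (i + k <= i')%N ->
  (i + k + a = n)%N -> (i' + l + b = n)%N ->
  whisker i x a ∘ whisker i' y b = whisker i' y b ∘ whisker i x a.
Proof.
move=> hx hy h e1 e2.
have -> : a = ((i' - (i + k)) + (l + b))%N by lia.
have -> : i' = (i + k + (i' - (i + k)))%N by lia.
have -> : (i + k + (i' - (i + k)) - (i + k) = i' - (i + k))%N by lia.
move: (i' - _)%N => c; rewrite !whiskerE (idd_add _ _ c (l + b)).
rewrite parA -[_ ⊗ y ⊗ _]parA.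
by rewrite par_comm; try typ.
Qed.

(* The modes are numbered V_0, H_0, V_1, H_1, ...; [sL n j] exchanges the modes
   [j] and [j + 1], and [gL n j U] applies [U] to the mode [j]. *)
Definition sL n j : diag :=
  locked (if odd j then whisker j./2 xs (n - j./2 - 2) else whisker j./2 ng (n - j./2 - 1)).

Definition gL n j U : diag :=
  locked (whisker j./2 (if odd j then hg U else kg U) (n - j./2 - 1)).

Lemma sL_even n i : sL n i.*2 = whisker i ng (n - i - 1).
Proof. by rewrite /sL -lock odd_double doubleK. Qed.

Lemma sL_odd n i : sL n i.*2.+1 = whisker i xs (n - i - 2).
Proof. by rewrite /sL -lock /= odd_double uphalf_double. Qed.

Lemma gL_even n i U : gL n i.*2 U = whisker i (kg U) (n - i - 1).
Proof. by rewrite /gL -lock odd_double doubleK. Qed.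

Lemma gL_odd n i U : gL n i.*2.+1 U = whisker i (hg U) (n - i - 1).
Proof. by rewrite /gL -lock /= odd_double uphalf_double. Qed.

Lemma parity j : exists i, j = i.*2 \/ j = i.*2.+1.
Proof.
exists j./2; rewrite -[j in j = _]odd_double_half -[j in _ \/ j = _]odd_double_half.
by case: (odd j); [right | left].
Qed.

Lemma ty_sL n j : (j.+1 < n.*2)%N -> ty n (sL n j).
Proof.
have [i [] ->] := parity j => h; rewrite ?sL_even ?sL_odd.
  by apply: (ty_whisker (k := 1)); [typ | lia].
by apply: (ty_whisker (k := 2)); [typ | lia].
Qed.

Lemma ty_gL n j U : (j < n.*2)%N -> ty n (gL n j U).
Proof.
have [i [] ->] := parity j => h; rewrite ?gL_even ?gL_odd;
  by apply: (ty_whisker (k := 1)); [typ | lia].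
Qed.

Lemma sL_sL n j : (j.+1 < n.*2)%N -> sL n j ∘ sL n j = idd n.
Proof.
have [i [] ->] := parity j => h; rewrite ?sL_even ?sL_odd.
  by rewrite (whisker_seq (k := 1)) ?ngK ?whisker_idd; try typ; congr idd; lia.
by rewrite (whisker_seq (k := 2)) ?xs_xs ?whisker_idd; try typ; congr idd; lia.
Qed.

(** This and the next six lemmas view the generators in one window of two wires, where relations
    between neighbours become identities of two-wire diagrams. *)
Lemma sL_even0 n i m : n = (i + 2 + m)%N -> sL n i.*2 = whisker i (ng ⊗ w) m.
Proof. by move=> ->; rewrite sL_even -whisker_r; congr whisker; lia. Qed.

Lemma sL_even1 n i m : n = (i + 2 + m)%N -> sL n i.*2.+2 = whisker i (w ⊗ ng) m.
Proof. by move=> ->; rewrite -doubleS sL_even -whisker_l; congr whisker; lia. Qed.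

Lemma sL_odd0 n i m : n = (i + 2 + m)%N -> sL n i.*2.+1 = whisker i xs m.
Proof. by move=> ->; rewrite sL_odd; congr whisker; lia. Qed.

Lemma gL0 n i m U : n = (i + 2 + m)%N -> gL n i.*2 U = whisker i (kg U ⊗ w) m.
Proof. by move=> ->; rewrite gL_even -whisker_r; congr whisker; lia. Qed.

Lemma gL1 n i m U : n = (i + 2 + m)%N -> gL n i.*2.+1 U = whisker i (hg U ⊗ w) m.
Proof. by move=> ->; rewrite gL_odd -whisker_r; congr whisker; lia. Qed.

Lemma gL2 n i m U : n = (i + 2 + m)%N -> gL n i.*2.+2 U = whisker i (w ⊗ kg U) m.
Proof. by move=> ->; rewrite -doubleS gL_even -whisker_l; congr whisker; lia. Qed.

Lemma gL3 n i m U : n = (i + 2 + m)%N -> gL n i.*2.+3 U = whisker i (w ⊗ hg U) m.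
Proof. by move=> ->; rewrite -doubleS gL_odd -whisker_l; congr whisker; lia. Qed.

Lemma sL_braid n j : (j.+2 < n.*2)%N ->
  sL n j ∘ sL n j.+1 ∘ sL n j = sL n j.+1 ∘ sL n j ∘ sL n j.+1.
Proof.
have [i [] ->] := parity j => h; have e : n = (i + 2 + (n - i - 2))%N by lia.
  rewrite (sL_even0 e) (sL_odd0 e) !(whisker_seq (k := 2)); try typ.
  by rewrite ng0_xs_ng0.
rewrite (sL_even1 e) (sL_odd0 e) !(whisker_seq (k := 2)); try typ.
by rewrite ng1_xs_ng1 xs_ng1_xs.
Qed.

Lemma sL_comm n j k : (j.+1 < k)%N -> (k.+1 < n.*2)%N ->
  sL n j ∘ sL n k = sL n k ∘ sL n j.
Proof.
have [i ji] := parity j; have [l kl] := parity k.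
case: ji kl => -> [] -> h1 h2; rewrite ?sL_even ?sL_odd.
- by apply: (@whisker_comm n _ _ 1 _ _ _ 1); try typ; lia.
- by apply: (@whisker_comm n _ _ 1 _ _ _ 2); try typ; lia.
- by apply: (@whisker_comm n _ _ 2 _ _ _ 1); try typ; lia.
(* Two consecutive [xs] share a wire although the modes they exchange are disjoint, so disjointness
   of wires does not settle this case. *)
have [e|ne] := eqVneq l i.+1; last first.
  by apply: (@whisker_comm n _ _ 2 _ _ _ 2); try typ; lia.
rewrite e whisker_l; have -> : (n - i - 2 = (n - i.+1 - 2).+1)%N by lia.
by rewrite whisker_r !(whisker_seq (k := 3)) ?xs_xs_comm; try typ.
Qed.

Lemma gL_mul n j U V : (j < n.*2)%N -> gL n j V ∘ gL n j U = gL n j (V *m U).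
Proof.
have [i [] ->] := parity j => h; rewrite ?gL_even ?gL_odd (whisker_seq (k := 1)); try typ;
  by rewrite ?kg_mul ?hg_mul.
Qed.

Lemma gL_1 n j : (j < n.*2)%N -> gL n j 1%:M = idd n.
Proof.
have [i [] ->] := parity j => h; rewrite ?gL_even ?gL_odd ?kg1 ?hg1 -idd1 whisker_idd;
  by congr idd; lia.
Qed.

Lemma sL_gL n j U : (j.+1 < n.*2)%N -> sL n j ∘ gL n j U = gL n j.+1 U ∘ sL n j.
Proof.
have [i [] ->] := parity j => h.
  rewrite sL_even gL_even gL_odd !(whisker_seq (k := 1)); try typ.
  by rewrite hg_ng.
have e : n = (i + 2 + (n - i - 2))%N by lia.
rewrite (sL_odd0 e) (gL1 _ e) (gL2 _ e) !(whisker_seq (k := 2)); try typ.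
by rewrite xs_hg0.
Qed.

Lemma sL_gLS n j U : (j.+1 < n.*2)%N -> sL n j ∘ gL n j.+1 U = gL n j U ∘ sL n j.
Proof.
move=> h; have ts := ty_sL h.
have tg0 : ty n (gL n j U) by apply: ty_gL; lia.
have tg1 : ty n (gL n j.+1 U) by apply: ty_gL; lia.
transitivity (sL n j ∘ (gL n j.+1 U ∘ sL n j) ∘ sL n j).
  by kill (sL_sL h).
by rewrite -sL_gL //; kill (sL_sL h).
Qed.

Lemma gL_comm n j k U V : (j < n.*2)%N -> (k < n.*2)%N -> j != k ->
  gL n j U ∘ gL n k V = gL n k V ∘ gL n j U.
Proof.
wlog lt_jk : j k U V / (j < k)%N.
  move=> H hj hk ne; have [lt|le] := ltnP j k; first exact: H.
  by apply/esym/H; rewrite // ?[k == j]eq_sym; lia.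
have [i ji] := parity j; have [l kl] := parity k.
case: ji kl lt_jk => -> [] -> lt_jk hj hk ne; rewrite ?gL_even ?gL_odd;
  try by (apply: (@whisker_comm n _ _ 1 _ _ _ 1); try typ; lia).
have [e|ne'] := eqVneq i l; last first.
  by apply: (@whisker_comm n _ _ 1 _ _ _ 1); try typ; lia.
by rewrite e !(whisker_seq (k := 1)) ?hg_kg; try typ.
Qed.

Lemma sL_gL_comm n j k U : (j.+1 < n.*2)%N -> (k < n.*2)%N -> k != j -> k != j.+1 ->
  sL n j ∘ gL n k U = gL n k U ∘ sL n j.
Proof.
have [i ji] := parity j; have [l kl] := parity k.
case: ji kl => -> [] -> hj hk ne1 ne2; rewrite ?sL_even ?sL_odd ?gL_even ?gL_odd.
- have [lt|le] := ltnP i l.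
    by apply: (@whisker_comm n _ _ 1 _ _ _ 1); try typ; lia.
  by apply/esym; apply: (@whisker_comm n _ _ 1 _ _ _ 1); try typ; lia.
- have [lt|le] := ltnP i l.
    by apply: (@whisker_comm n _ _ 1 _ _ _ 1); try typ; lia.
  by apply/esym; apply: (@whisker_comm n _ _ 1 _ _ _ 1); try typ; lia.
- have e : n = (i + 2 + (n - i - 2))%N by lia.
  have [lt|le] := ltnP i.+1 l.
    by apply: (@whisker_comm n _ _ 2 _ _ _ 1); try typ; lia.
  have [lt|le'] := ltnP l i.
    by apply/esym; apply: (@whisker_comm n _ _ 1 _ _ _ 2); try typ; lia.
  have -> : l = i by lia.
  rewrite -gL_even (gL0 _ e) !(whisker_seq (k := 2)); try typ.
  by rewrite xs_kg0.
have e : n = (i + 2 + (n - i - 2))%N by lia.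
have [lt|le] := ltnP i.+1 l.
  by apply: (@whisker_comm n _ _ 2 _ _ _ 1); try typ; lia.
have [lt|le'] := ltnP l i.
  by apply/esym; apply: (@whisker_comm n _ _ 1 _ _ _ 2); try typ; lia.
have -> : l = i.+1 by lia.
rewrite -gL_odd doubleS (gL3 _ e) !(whisker_seq (k := 2)); try typ.
by rewrite xs_hg1.
Qed.

End Coxeter.

(** * Square roots of invertible matrices *)

Section SquareRoot.

(* A square root of ['X] modulo [m] lifts to one modulo [m * ('X - a%:P)] by
   adding a multiple [r *: m], where [r] solves an equation of degree at most 2
   that is not constant as [a != 0]. *)
Lemma sqrt_polyX (C : numClosedFieldType) (rs : seq C) :
  0 \notin rs ->
  exists p : {poly C}, \prod_(a <- rs) ('X - a%:P) %| p ^+ 2 - 'X.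
Proof.
elim: rs => [|a rs IH]; first by exists 0; rewrite big_nil dvd1p.
rewrite inE negb_or eq_sym big_cons => /andP[a0 /IH[p]].
set m := \prod_(_ <- _) _ => /dvdpP[s es].
have pa : p.[a] ^+ 2 - a = s.[a] * m.[a].
  by have := congr1 (horner^~ a) es; rewrite !hornerE.
have [r er] : exists r, s.[a] + 2 * p.[a] * r + m.[a] * r ^+ 2 = 0.
  have [ma|ma] := eqVneq m.[a] 0.
    have pa0 : p.[a] != 0.
      by apply: contraNneq a0 => p0; move: pa; rewrite p0 ma mulr0 expr0n sub0r => /eqP; rewrite oppr_eq0.
    exists (- s.[a] / (2 * p.[a])); rewrite ma mul0r addr0.
    by rewrite mulrCA mulfV ?mulr1 ?subrr // mulf_neq0 // pnatr_eq0.
  have [r /eqP er] : exists r, root (Poly [:: s.[a]; 2 * p.[a]; m.[a]]) r.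
    by apply/closed_rootP; rewrite (@PolyK _ 0).
  by exists r; move: er; rewrite horner_Poly /= => <-; ring.
exists (p + r%:P * m).
have -> : (p + r%:P * m) ^+ 2 - 'X = (s + 2 * r%:P * p + r%:P ^+ 2 * m) * m.
  by transitivity ((p ^+ 2 - 'X) + (2 * r%:P * p + r%:P ^+ 2 * m) * m); [|rewrite es]; ring.
apply: dvdp_mul => //; rewrite dvdp_XsubCl rootE !hornerE -[X in _ == X]er.
by apply/eqP; ring.
Qed.

(** Invertibility keeps 0 from being an eigenvalue, so 'X has a square root modulo the
    characteristic polynomial; evaluate it at [A] and apply Cayley-Hamilton. *)
Lemma sqrtmx (C : numClosedFieldType) (q : nat) (A : 'M[C]_q) :
  A \in unitmx -> exists S, S *m S = A.
Proof.
case: q A => [|q] A uA; first by exists A; apply/matrixP => -[].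
have [rs ers] := closed_field_poly_normal (char_poly A).
rewrite (monicP (char_poly_monic A)) scale1r in ers.
have /sqrt_polyX[p /dvdpP[s es]] : 0 \notin rs.
  apply/negP; rewrite -root_prod_XsubC -ers -eigenvalue_root_char.
  case/eigenvalueP => v; rewrite scale0r => vA; case/negP.
  by rewrite -[v](mulmxK uA) vA mul0mx.
exists (horner_mx A p).
have := congr1 (horner_mx A) es.
rewrite -ers rmorphM /= Cayley_Hamilton mulr0 rmorphB rmorphXn /= horner_mx_X.
by move/eqP; rewrite subr_eq0 expr2 => /eqP.
Qed.

End SquareRoot.

(** * Elimination of traces from words *)

Section Words.
Variables (R : realType) (q : nat).
Notation diag := (diag R q).
Implicit Types (U V X Y S : 'M[R[i]]_q) (x y z : diag) (n i j k l N : nat).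

(* Products of generators on [n] wires that involve only the first [N] modes. *)
Inductive word n N : diag -> Prop :=
| word_id : word n N (idd n)
| word_sL j x : (j.+1 < N)%N -> word n N x -> word n N (sL R q n j ∘ x)
| word_gL j U x : (j < N)%N -> U \in unitmx -> word n N x ->
    word n N (gL n j U ∘ x).

Lemma ty_word n N x : (N <= n.*2)%N -> word n N x -> ty n x.
Proof.
move=> hN; elim=> [|j {}x hj _ IH|j U {}x hj _ _ IH]; first by typ.
  by apply: ty_seq => //; apply: ty_sL; lia.
by apply: ty_seq => //; apply: ty_gL; lia.
Qed.

Lemma word_seq n N x y : (N <= n.*2)%N -> word n N x -> word n N y ->
  word n N (x ∘ y).
Proof.
move=> hN hx hy; elim: hx => [|j {}x hj _ IH|j U {}x hj hU _ IH].
- by rewrite (seq1d (ty_word hN hy)).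
- by rewrite -seqA; apply: word_sL.
- by rewrite -seqA; apply: word_gL.
Qed.

Lemma word_sL1 n N j : (N <= n.*2)%N -> (j.+1 < N)%N -> word n N (sL R q n j).
Proof.
move=> hN hj; rewrite -(@seqd1 _ _ n (sL _ _ _ _)); last by apply: ty_sL; lia.
by apply: word_sL => //; apply: word_id.
Qed.

Lemma word_gL1 n N j U : (N <= n.*2)%N -> (j < N)%N -> U \in unitmx ->
  word n N (gL n j U).
Proof.
move=> hN hj hU; rewrite -(@seqd1 _ _ n (gL _ _ _)); last by apply: ty_gL; lia.
by apply: word_gL => //; apply: word_id.
Qed.

(* The coset representative [s_k ∘ s_(k+1) ∘ ... ∘ s_(k+m-1)]. *)
Fixpoint cL n k m : diag :=
  if m is m'.+1 then sL R q n k ∘ cL n k.+1 m' else idd n.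

Lemma word_cL n N k m : (k + m < N)%N -> word n N (cL n k m).
Proof.
elim: m k => [|m IH] k h /=; first exact: word_id.
by apply: word_sL; [lia | apply: IH; lia].
Qed.

Lemma ty_cL n k m : (k + m < n.*2)%N -> ty n (cL n k m).
Proof. by move=> h; apply: (ty_word (leqnn _)); apply: word_cL. Qed.

Lemma cL_cat n k m m' : (k + m + m' < n.*2)%N ->
  cL n k (m + m') = cL n k m ∘ cL n (k + m) m'.
Proof.
elim: m k => [|m IH] k h /=.
  by rewrite add0n addn0 (seq1d (k := n)) //; apply: ty_cL; lia.
by rewrite IH ?addSnnS ?seqA //; lia.
Qed.

Lemma cL1 n k : (k.+1 < n.*2)%N -> cL n k 1 = sL R q n k.
Proof. by move=> h /=; rewrite (seqd1 (k := n)) //; apply: ty_sL. Qed.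

Lemma commute_cL n k m x : (k + m < n.*2)%N -> ty n x ->
  (forall j, (k <= j < k + m)%N -> x ∘ sL R q n j = sL R q n j ∘ x) ->
  x ∘ cL n k m = cL n k m ∘ x.
Proof.
move=> + hx; elim: m k => [|m IH] k h c /=.
  by rewrite (seq1d hx) (seqd1 hx).
rewrite seqA c -?seqA ?IH //; try lia.
by move=> j hj; apply: c; lia.
Qed.

Lemma sL_cL_low n j k m : (j.+1 < k)%N -> (k + m < n.*2)%N ->
  sL R q n j ∘ cL n k m = cL n k m ∘ sL R q n j.
Proof.
move=> h1 h2; apply: commute_cL => //; first by apply: ty_sL; lia.
by move=> i hi; apply: sL_comm; lia.
Qed.

Lemma sL_cL_high n j k m : (k + m < j)%N -> (j.+1 < n.*2)%N ->
  sL R q n j ∘ cL n k m = cL n k m ∘ sL R q n j.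
Proof.
move=> h1 h2; apply: commute_cL; [lia | by apply: ty_sL; lia |].
by move=> i hi; apply/esym/sL_comm; lia.
Qed.

(** One braid move where the index occurs in the representative; the generators before and after are
    far enough to commute. *)
Lemma sL_cL_mid n j k m : (k <= j)%N -> (j.+1 < k + m)%N -> (k + m < n.*2)%N ->
  sL R q n j.+1 ∘ cL n k m = cL n k m ∘ sL R q n j.
Proof.
elim: m k => [|m IH] k h1 h2 h3; first by lia.
have [e|ne] := eqVneq j k; last first.
  rewrite /= seqA -(@sL_comm _ _ n k j.+1); try lia.
  by rewrite -!seqA IH //; lia.
case: m IH h2 h3 => [|m] _ h2 h3; first by lia.
rewrite e /= !seqA -sL_braid; try lia.
by rewrite -!seqA sL_cL_low //; lia.
Qed.

(** On modes, [cL n k m] is the cycle sending k + m to k and j to j + 1 for k <= j < k + m; this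
    lemma and the next two let a gate follow it. *)
Lemma gL_cL_out n j k m U : (j < k)%N || (k + m < j)%N -> (k + m < n.*2)%N ->
  (j < n.*2)%N -> gL n j U ∘ cL n k m = cL n k m ∘ gL n j U.
Proof.
move=> h1 h2 h3; apply: commute_cL => //; first exact: ty_gL.
by move=> i hi; apply/esym/sL_gL_comm; lia.
Qed.

Lemma gL_cL_first n k m U : (k + m < n.*2)%N ->
  gL n k U ∘ cL n k m = cL n k m ∘ gL n (k + m) U.
Proof.
elim: m k => [|m IH] k h /=.
  by rewrite addn0 (seqd1 (k := n)) ?(seq1d (k := n)) //; apply: ty_gL; lia.
rewrite seqA -sL_gLS; last by lia.
by rewrite -!seqA IH ?addSnnS //; lia.
Qed.

Lemma gL_cL_mid n j k m U : (k <= j < k + m)%N -> (k + m < n.*2)%N ->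
  gL n j.+1 U ∘ cL n k m = cL n k m ∘ gL n j U.
Proof.
elim: m k => [|m IH] k h1 h2; first by lia.
have [e|ne] := eqVneq j k.
  rewrite e /= seqA -sL_gL; last by lia.
  by rewrite -!seqA gL_cL_out //; lia.
rewrite /= seqA -sL_gL_comm; try lia.
by rewrite -!seqA IH //; lia.
Qed.

(** Induction on the word: a generator meeting the representative either moves [k] by one or crosses
    it and joins the word on the first N modes. A gate crosses likewise, unless it sits on mode [k]:
    then it ends on mode N and is collected in [U]. *)
Lemma word_peel n N x : (N < n.*2)%N -> word n N.+1 x ->
  exists k U y, [/\ (k <= N)%N, U \in unitmx, word n N y &
    x = cL n k (N - k) ∘ gL n N U ∘ y].
Proof.
move=> hN; elim=> [|j {}x hj _ [k [U [y [hk hU hy ->]]]]|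
                    j V {}x hj hV _ [k [U [y [hk hU hy ->]]]]].
- exists N, 1%:M, (idd n); split => //; [exact: unitmx1 | exact: word_id |].
  by rewrite subnn /= gL_1 // !(seq1d (k := n)) //; typ.
- have hkN : (k + (N - k) = N)%N by lia.
  have [lt|ge] := ltnP j.+1 k.
    exists k, U, (sL R q n j ∘ y); split => //; first by apply: word_sL => //; lia.
    rewrite !seqA sL_cL_low; try lia.
    by rewrite -[_ ∘ sL _ _ _ _ ∘ _]seqA sL_gL_comm ?seqA //; lia.
  have [e|ne1] := eqVneq j.+1 k.
    exists j, U, y; split => //; first by lia.
    have -> : (N - j = (N - k).+1)%N by lia.
    by rewrite /= e !seqA.
  have [e|ne2] := eqVneq j k.
    exists j.+1, U, y; split => //.
    have -> : (N - k = (N - j.+1).+1)%N by lia.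
    rewrite /= e !seqA sL_sL; last by lia.
    by rewrite (seq1d (k := n)) //; apply: ty_cL; lia.
  case: j ge ne1 ne2 hj => [|j] ge ne1 ne2 hj; first by lia.
  exists k, U, (sL R q n j ∘ y); split => //; first by apply: word_sL => //; lia.
  rewrite !seqA sL_cL_mid; try lia.
  by rewrite -[_ ∘ sL _ _ _ _ ∘ _]seqA sL_gL_comm ?seqA //; lia.
have hkN : (k + (N - k) = N)%N by lia.
have c i : (i < N)%N -> gL n i V ∘ gL n N U = gL n N U ∘ gL n i V.
  by move=> hi; apply: gL_comm; lia.
have [lt|ge] := ltnP j k.
  exists k, U, (gL n j V ∘ y); split => //; first by apply: word_gL => //; lia.
  rewrite !seqA gL_cL_out; try lia.
  have hj' : (j < N)%N by lia.
  by rw (c j hj').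
have [e|ne] := eqVneq j k.
  exists k, (V *m U), y; split => //; first by rewrite unitmx_mul hV.
  rewrite e !seqA gL_cL_first ?hkN; try lia.
  by rw (gL_mul U V hN).
case: j ge ne hj => [|j] ge ne hj; first by lia.
exists k, U, (gL n j V ∘ y); split => //; first by apply: word_gL => //; lia.
rewrite !seqA gL_cL_mid; try lia.
by rw (c j hj).
Qed.

End Words.

(** * The trace of a word is a word *)

Section TraceElimination.
Variables (R : realType) (q : nat).
Notation diag := (diag R q).
Implicit Types (U V X Y S : 'M[R[i]]_q) (x y z p : diag) (n i j k l m N : nat).
Notation sL := (sL R q).
Notation cL := (cL R q).

Lemma whisker_w i j x : whisker i x j.+1 = whisker i x j ⊗ w.
Proof. by rewrite !whiskerE iddS !parA. Qed.

Lemma sL_w n j : (j.+1 < n.*2)%N -> sL n.+1 j = sL n j ⊗ w.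
Proof.
by have [i [] ->] := parity j => h; rewrite ?sL_even ?sL_odd -whisker_w; congr whisker; lia.
Qed.

Lemma gL_w n j U : (j < n.*2)%N -> gL n.+1 j U = gL n j U ⊗ w.
Proof.
by have [i [] ->] := parity j => h; rewrite ?gL_even ?gL_odd -whisker_w; congr whisker; lia.
Qed.

Lemma word_restrict n x : word n.+1 n.*2 x ->
  exists2 y, word n n.*2 y & x = y ⊗ w.
Proof.
elim=> [|j {}x hj _ [y hy ->]|j U {}x hj hU _ [y hy ->]].
- by exists (idd n); [exact: word_id | rewrite iddS].
- exists (sL n j ∘ y); first exact: word_sL.
  by rewrite sL_w // (parwl (n := n)) //; [apply: ty_sL | apply: ty_word hy].
exists (gL n j U ∘ y); first exact: word_gL.
by rewrite gL_w // (parwl (n := n)) //; [apply: ty_gL | apply: ty_word hy].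
Qed.

Lemma word_tr_l n p x : word n.+1 n.*2 p -> ty n.+1 x ->
  word n n.*2 (trd x) -> word n n.*2 (trd (p ∘ x)).
Proof.
move=> /word_restrict[y hy ->] hx h; rewrite (tr_out (n := n)) //.
  exact: word_seq.
exact: ty_word hy.
Qed.

Lemma word_tr_r n p x : word n.+1 n.*2 p -> ty n.+1 x ->
  word n n.*2 (trd x) -> word n n.*2 (trd (x ∘ p)).
Proof.
move=> /word_restrict[y hy ->] hx h; rewrite (tr_in (n := n)) //.
  exact: word_seq.
exact: ty_word hy.
Qed.

Lemma tr_whisker m k x : ty k.+1 x -> trd (whisker m x 0) = whisker m (trd x) 0.
Proof. by move=> hx; rewrite !whiskerE idd0 !par_eps (tr_super (n := m) (m := k)) //; typ. Qed.

Lemma tr_whisker1 m x : ty 1 x -> trd (whisker m x 0) = whisker m (trd x) 0.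
Proof. exact: tr_whisker. Qed.

Lemma tr_whisker2 m x : ty 2 x -> trd (whisker m x 0) = whisker m (trd x) 0.
Proof. exact: tr_whisker. Qed.

Lemma word_hg m U : U \in unitmx -> word m.+1 m.+1.*2 (whisker m (hg U) 0).
Proof.
move=> hU; have -> : whisker m (hg U) 0 = gL m.+1 m.*2.+1 U by rewrite gL_odd; congr whisker; lia.
by apply: word_gL1 => //; lia.
Qed.

Lemma word_kg m U : U \in unitmx -> word m.+1 m.+1.*2 (whisker m (kg U) 0).
Proof.
move=> hU; have -> : whisker m (kg U) 0 = gL m.+1 m.*2 U by rewrite gL_even; congr whisker; lia.
by apply: word_gL1 => //; lia.
Qed.

Lemma tr_ng_kg_hg_unit U V : U \in unitmx -> V \in unitmx ->
  trd (ng ∘ (kg U ∘ hg V)) = epsd.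
Proof.
move=> hU hV; have [|S hS] := @sqrtmx R[i] _ (V *m U); first by rewrite unitmx_mul hV.
exact: tr_ng_kg_hg hS.
Qed.

Lemma ng1_xs : (w ⊗ ng) ∘ xs = bs ∘ (w ⊗ ng) :> diag.
Proof. by rewrite xsE; kill ng1ng1. Qed.

Lemma xs_ng1 : xs ∘ (w ⊗ ng) = (w ⊗ ng) ∘ bs :> diag.
Proof. by rewrite xsE; kill ng1ng1. Qed.

(* In terms of the modes a, b of the last but one wire and c, d of the last one,
   [sa_whisker], [sb_whisker] and [sc_whisker] describe the generators (a b),
   (b c) and (c d). *)
Lemma sb_whisker m : sL m.+2 m.*2.+1 = whisker m xs 0.
Proof. by apply: sL_odd0; lia. Qed.

Lemma sc_whisker m : sL m.+2 m.*2.+2 = whisker m (w ⊗ ng) 0.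
Proof. by apply: sL_even1; lia. Qed.

Lemma sa_whisker m : sL m.+2 m.*2 = whisker m (ng ⊗ w) 0.
Proof. by apply: sL_even0; lia. Qed.

Lemma cL_rcons n k j : (k <= j)%N -> (j.+1 < n.*2)%N ->
  cL n k (j.+1 - k) = cL n k (j - k) ∘ sL n j.
Proof.
move=> h1 h2; have -> : (j.+1 - k = (j - k) + 1)%N by lia.
by rewrite cL_cat ?cL1 ?subnKC //; lia.
Qed.

Lemma word_tr_kernel m p x : word m.+2 m.+1.*2 p -> ty 2 x ->
  word m.+1 m.+1.*2 (whisker m (trd x) 0) ->
  word m.+1 m.+1.*2 (trd (p ∘ whisker m x 0)).
Proof.
move=> hp hx h; apply: word_tr_l => //; last by rewrite tr_whisker2.
by apply: (ty_whisker hx); lia.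
Qed.

(** The two double cosets in which both modes of the traced wire return to it, directly or
    exchanged: the loop is closed off and worth [epsd]. *)
Lemma word_tr_coset_last n k U V : (n.*2 <= k <= n.*2.+1)%N ->
  U \in unitmx -> V \in unitmx ->
  word n n.*2 (trd (cL n.+1 k (n.*2.+1 - k) ∘ whisker n (kg U ∘ hg V) 0)).
Proof.
move=> hk hU hV; have tX : ty 1 (kg U ∘ hg V) by typ.
have tL : ty n.+1 (whisker n (kg U ∘ hg V) 0) by apply: ty_whisker tX _; lia.
suff : word n n.*2 (whisker n (epsd : diag) 0).
  have [->|ek] := eqVneq k n.*2.+1.
    by rewrite subnn /= (seq1d (k := n.+1)) // tr_whisker1 ?tr_kg_hg; try typ.
  have -> : (n.*2.+1 - k = 1)%N by lia.
  have -> : k = n.*2 by lia.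
  rewrite cL1 ?sL_even; last by lia.
  have -> : (n.+1 - n - 1 = 0)%N by lia.
  by rewrite (whisker_seq (k := 1)) ?tr_whisker1 ?tr_ng_kg_hg_unit //; try typ.
by rewrite whiskerE idd0 !par_eps; exact: word_id.
Qed.

(* [k] and [l] are the positions of the two coset representatives peeled off a
   word; what remains of them next to the traced wire is one of the seven
   double cosets of S_(2n) in S_(2n+2). *)
Lemma word_tr_coset n k l U V : (k <= n.*2.+1)%N -> (l <= n.*2)%N ->
  U \in unitmx -> V \in unitmx ->
  word n n.*2 (trd (cL n.+1 k (n.*2.+1 - k) ∘ cL n.+1 l (n.*2 - l) ∘
                   whisker n (kg U ∘ hg V) 0)).
Proof.
move=> hk hl hU hV.
have hUV : U *m V \in unitmx by rewrite unitmx_mul hU.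
have hVU : V *m U \in unitmx by rewrite unitmx_mul hV.
have tX : ty 1 (kg U ∘ hg V) by typ.
have [/andP[/eqP -> hk'] | {}hkl] := boolP ((l == n.*2) && (n.*2 <= k)%N).
  rewrite subnn /= (seqd1 (k := n.+1)); first by apply: word_tr_coset_last => //; lia.
  by apply: ty_cL; lia.
case: n => [|m] in hk hl hkl *; first by lia.
have -> : whisker m.+1 (kg U ∘ hg V) 0 = whisker m (w ⊗ (kg U ∘ hg V)) 0.
  exact: whisker_l.
have ty_c k' m' : (k' + m' < m.+2.*2)%N -> ty m.+2 (cL m.+2 k' m') by exact: ty_cL.
have tb : ty m.+2 (whisker m (xs : diag) 0) by rewrite -sb_whisker; apply: ty_sL; lia.
have tc : ty m.+2 (whisker m (w ⊗ ng : diag) 0) by rewrite -sc_whisker; apply: ty_sL; lia.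
have [lt_k|ge_k] := ltnP k m.+1.*2.
  have -> : cL m.+2 k (m.+1.*2.+1 - k) =
      cL m.+2 k (m.*2.+1 - k) ∘ whisker m xs 0 ∘ whisker m (w ⊗ ng) 0.
    by rewrite -sb_whisker -sc_whisker -!cL_rcons //; lia.
  have wk : word m.+2 m.+1.*2 (cL m.+2 k (m.*2.+1 - k)) by apply: word_cL; lia.
  have [->|ne_l] := eqVneq l m.+1.*2.
    rewrite subnn /= (seqd1 (k := m.+2)); last first.
      by do 2?apply: ty_seq => //; apply: ty_c; lia.
    rewrite -!seqA !(whisker_seq (k := 2)); try typ.
    apply: word_tr_kernel => //; first by typ.
    by rewrite seqA xs_ng1 tr_ng_bs_kg_hg; apply: word_hg.
  have [->|ne_l'] := eqVneq l m.*2.+1.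
    have -> : (m.+1.*2 - m.*2.+1 = 1)%N by lia.
    rewrite cL1 ?sb_whisker; last by lia.
    rewrite -!seqA !(whisker_seq (k := 2)); try typ.
    apply: word_tr_kernel => //; first by typ.
    by rewrite !seqA xs_ng1_xs tr_bs_kg_hg //; apply: word_hg.
  (* In this case no mode of the traced wire returns to it. The prefix of the second representative
     commutes with (b c) and (c d) and moves out to the left; the core (b c)(c d)(a b)(b c) is a
     swap. *)
  have -> : cL m.+2 l (m.+1.*2 - l) =
      cL m.+2 l (m.*2 - l) ∘ whisker m (ng ⊗ w) 0 ∘ whisker m xs 0.
    by rewrite -sb_whisker -sa_whisker -!cL_rcons //; lia.
  have wl : word m.+2 m.+1.*2 (cL m.+2 l (m.*2 - l)) by apply: word_cL; lia.
  have eb : whisker m xs 0 ∘ cL m.+2 l (m.*2 - l) = cL m.+2 l (m.*2 - l) ∘ whisker m xs 0.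
    by rewrite -sb_whisker sL_cL_high //; lia.
  have ec : whisker m (w ⊗ ng) 0 ∘ cL m.+2 l (m.*2 - l) =
      cL m.+2 l (m.*2 - l) ∘ whisker m (w ⊗ ng) 0.
    by rewrite -sc_whisker sL_cL_high //; lia.
  rw ec; rw eb.
  have := word_seq _ wk wl; rewrite leq_double leqW // => /(_ isT).
  move: (_ ∘ cL m.+2 l _) => p wp.
  rewrite -!seqA !(whisker_seq (k := 2)); try typ.
  apply: word_tr_kernel => //; first by typ.
  rewrite !seqA xs_sw tr_sw_par // -(whisker_seq (k := 1)); try typ.
  by apply: word_seq => //; [apply: word_kg | apply: word_hg].
(* Here [k] is a mode of the traced wire, so the first representative is trivial or the negation of
   that wire, and [l] is not such a mode by [hkl]. *)
have -> : cL m.+2 l (m.+1.*2 - l) = cL m.+2 l (m.*2.+1 - l) ∘ whisker m xs 0.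
  by rewrite -sb_whisker -cL_rcons //; lia.
have wl : word m.+2 m.+1.*2 (cL m.+2 l (m.*2.+1 - l)) by apply: word_cL; lia.
have [->|ne_k] := eqVneq k m.+1.*2.+1.
  rewrite subnn /= (seq1d (k := m.+2)); last by apply: ty_seq => //; apply: ty_c; lia.
  rewrite -!seqA !(whisker_seq (k := 2)); try typ.
  apply: word_tr_kernel => //; first by typ.
  by rewrite tr_xs //; apply: word_hg.
have -> : k = m.*2.+2 by lia.
have -> : (m.+1.*2.+1 - m.*2.+2 = 1)%N by lia.
rewrite cL1 ?sc_whisker; last by lia.
have ec : whisker m (w ⊗ ng) 0 ∘ cL m.+2 l (m.*2.+1 - l) =
    cL m.+2 l (m.*2.+1 - l) ∘ whisker m (w ⊗ ng) 0.
  by rewrite -sc_whisker sL_cL_high //; lia.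
rw ec; rewrite -!seqA !(whisker_seq (k := 2)); try typ.
apply: word_tr_kernel => //; first by typ.
by rewrite seqA ng1_xs tr_bs_ng_kg_hg; apply: word_hg.
Qed.

Lemma word_tr n x : word n.+1 n.+1.*2 x -> word n n.*2 (trd x).
Proof.
move=> h; have h1 : (n.*2.+1 < n.+1.*2)%N by lia.
have h2 : (n.*2 < n.+1.*2)%N by lia.
have [k [V [x1 [hk hV hx1 ->]]]] := word_peel h1 h.
have [l [U [x2 [hl hU hx2 ->]]]] := word_peel h2 hx1.
rewrite !seqA; apply: word_tr_r => //.
  do 3?apply: ty_seq; try (by apply: ty_cL; lia); by apply: ty_gL; lia.
have -> : cL n.+1 k (n.*2.+1 - k) ∘ gL n.+1 n.*2.+1 V ∘ cL n.+1 l (n.*2 - l) =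
    cL n.+1 k (n.*2.+1 - k) ∘ cL n.+1 l (n.*2 - l) ∘ gL n.+1 n.*2.+1 V.
  by rewrite -!seqA gL_cL_out //; lia.
have -> : gL n.+1 n.*2.+1 V = whisker n (hg V) 0 by rewrite gL_odd; congr whisker; lia.
have -> : gL n.+1 n.*2 U = whisker n (kg U) 0 by rewrite gL_even; congr whisker; lia.
rewrite -[_ ∘ _ ∘ whisker n (kg U) 0]seqA (whisker_seq (k := 1)); try typ.
by rewrite hg_kg; apply: word_tr_coset.
Qed.

(** * Diagrams with invertible gates are words *)

Lemma sL_shift m n j : (j.+1 < n.*2)%N ->
  idd m ⊗ sL n j = sL (m + n) (m.*2 + j).
Proof.
have [i [] ->] := parity j => h; rewrite ?addnS -doubleD ?sL_even ?sL_odd;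
  by rewrite !whiskerE idd_add !parA; congr (_ ⊗ idd _); lia.
Qed.

Lemma gL_shift m n j U : (j < n.*2)%N ->
  idd m ⊗ gL n j U = gL (m + n) (m.*2 + j) U.
Proof.
have [i [] ->] := parity j => h; rewrite ?addnS -doubleD ?gL_even ?gL_odd;
  by rewrite !whiskerE idd_add !parA; congr (_ ⊗ idd _); lia.
Qed.

Lemma word_par_l n m x : word n n.*2 x -> word (m + n) (m + n).*2 (idd m ⊗ x).
Proof.
have one : idd m = idd m ∘ idd m :> diag by rewrite (seq1d (k := m)); typ.
elim=> [|j {}x hj hx IH|j U {}x hj hU hx IH].
- by rewrite -idd_add; exact: word_id.
- rewrite one (par_seq (n := m) (m := n)) ?sL_shift //; try typ.
  + by apply: word_sL => //; lia.
  + exact: ty_sL.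
  + exact: ty_word hx.
- rewrite one (par_seq (n := m) (m := n)) ?gL_shift //; try typ.
  + by apply: word_gL => //; lia.
  + exact: ty_gL.
  + exact: ty_word hx.
Qed.

Lemma word_w n x : word n n.*2 x -> word n.+1 n.+1.*2 (x ⊗ w).
Proof.
elim=> [|j {}x hj hx IH|j U {}x hj hU hx IH].
- by rewrite -iddS; exact: word_id.
- rewrite -(parwl (n := n)) -?sL_w //; first by apply: word_sL => //; lia.
  + by apply: ty_sL; lia.
  + exact: ty_word hx.
- rewrite -(parwl (n := n)) -?gL_w //; first by apply: word_gL => //; lia.
  + by apply: ty_gL; lia.
  + exact: ty_word hx.
Qed.

Lemma word_par_r n m x : word n n.*2 x -> word (n + m) (n + m).*2 (x ⊗ idd m).
Proof.
move=> h; elim: m => [|m IH]; first by rewrite addn0 idd0 par_eps.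
by rewrite addnS iddS parA; apply: word_w.
Qed.

Lemma word_par n m x y : word n n.*2 x -> word m m.*2 y ->
  word (n + m) (n + m).*2 (x ⊗ y).
Proof.
move=> hx hy; rewrite -(par_split (n := n) (m := m)).
- by apply: word_seq => //; [apply: word_par_r | apply: word_par_l].
- exact: ty_word hx.
- exact: ty_word hy.
Qed.

Lemma whisker00 x : whisker 0 x 0 = x.
Proof. by rewrite whiskerE idd0 eps_par par_eps. Qed.

Lemma word_cls (D : term R q) n : has_type D n ->
  (forall U, gate_in U D -> U \in unitmx) -> word n n.*2 (cls D).
Proof.
have xsW : word 2 2.*2 (xs : diag).
  by rewrite -[xs]whisker00 -sb_whisker; apply: word_sL1.
have n1W : word 2 2.*2 (w ⊗ ng : diag).
  by rewrite -[_ ⊗ _]whisker00 -sc_whisker; apply: word_sL1.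
have n0W : word 2 2.*2 (ng ⊗ w : diag).
  by rewrite -[_ ⊗ _]whisker00 -sa_whisker; apply: word_sL1.
elim=> {D n} [| | | | |U|n D2 D1 _ IH2 _ IH1|n m D1 D2 _ IH1 _ IH2|n D _ IH] hU.
- exact: word_id.
- by rewrite -/w -idd1; exact: word_id.
- have -> : cls Neg = sL 1 0 by rewrite (sL_even _ _ 1 0) whisker00.
  exact: word_sL1.
- by rewrite -/sw -xs_sw; do 3?apply: word_seq.
- by rewrite -/bs -ng1_xs_ng1; do 2?apply: word_seq.
- rewrite -/(ga U) -hg_kg_ga -[hg U]whisker00 -[kg U]whisker00.
  by apply: word_seq => //; [apply: word_hg | apply: word_kg]; apply: hU.
- rewrite cls_Seq; apply: word_seq => //.
    by apply: IH2 => U h; apply: hU; left.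
  by apply: IH1 => U h; apply: hU; right.
- rewrite cls_Par; apply: word_par.
    by apply: IH1 => U h; apply: hU; left.
  by apply: IH2 => U h; apply: hU; right.
rewrite cls_Tr; apply: word_tr; rewrite -addn1; exact: IH.
Qed.

(** * Words on at least two wires are trace-free *)

Definition tfree n x :=
  exists D : term R q, [/\ has_type D n, trace_free_term D & cls D = x].

Lemma tfree_seq n x y : tfree n x -> tfree n y -> tfree n (x ∘ y).
Proof.
move=> [D2 [h2 t2 <-]] [D1 [h1 t1 <-]]; exists (Seq D2 D1).
by rewrite cls_Seq /= t1 t2; split=> //; apply: type_Seq.
Qed.

Lemma tfree_par n m x y : tfree n x -> tfree m y -> tfree (n + m) (x ⊗ y).
Proof.
move=> [D2 [h2 t2 <-]] [D1 [h1 t1 <-]]; exists (Par D2 D1).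
by rewrite cls_Par /= t1 t2; split=> //; apply: type_Par.
Qed.

Lemma tfree_idd n : tfree n (idd n).
Proof.
exists (wires n); split=> //; first exact: wires_type.
by elim: n => //= n ->.
Qed.

Lemma tfree_w : tfree 1 w.
Proof. by rewrite -idd1; apply: tfree_idd. Qed.

Lemma tfree_ng : tfree 1 ng.
Proof. by exists Neg; split=> //; constructor. Qed.

Lemma tfree_sw : tfree 2 sw.
Proof. by exists Swap; split=> //; constructor. Qed.

Lemma tfree_bs : tfree 2 bs.
Proof. by exists Beam; split=> //; constructor. Qed.

Lemma tfree_ga U : tfree 1 (ga U).
Proof. by exists (Gate U); split=> //; constructor. Qed.

Lemma tfree_par11 x y : tfree 1 x -> tfree 1 y -> tfree 2 (x ⊗ y).
Proof. exact: tfree_par. Qed.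

Lemma tfree_whisker n k i x j : tfree k x -> n = (i + k + j)%N -> tfree n (whisker i x j).
Proof.
by move=> hx ->; rewrite whiskerE; do 2?apply: tfree_par => //; apply: tfree_idd.
Qed.

Lemma tfree_xs : tfree 2 xs.
Proof.
have h : tfree 2 (w ⊗ ng) by apply: tfree_par11; [apply: tfree_w | apply: tfree_ng].
by rewrite xsE; do 2?apply: tfree_seq => //; apply: tfree_bs.
Qed.

Lemma tfree_sL n j : (j.+1 < n.*2)%N -> tfree n (sL n j).
Proof.
have [i [] ->] := parity j => h; rewrite ?sL_even ?sL_odd.
  by apply: (tfree_whisker tfree_ng); lia.
by apply: (tfree_whisker tfree_xs); lia.
Qed.

(** Conjugation by [bs] moves the H part of the gate to the second wire and leaves the V part: a
    trace-free gate on V_0 and H_1. *)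
Lemma bs_ga0_bs U : bs ∘ (ga U ⊗ w) ∘ bs = (kg U ⊗ w) ∘ (w ⊗ hg U).
Proof.
have th : ty 1 (hg U) by typ. have tk : ty 1 (kg U) by typ.
rewrite -hg_kg_ga hg_kg -(parwl (n := 1)) // seqA bs_kg0.
by rw (bs_hg0 U); kill bs_bs.
Qed.

(* Three gates, each acting on two of the modes H_0, V_0 and H_1, combine to
   act on H_0 only. *)
Lemma hg_sqr_w S : S \in unitmx -> hg (S *m S) ⊗ w =
  (ga S ⊗ w) ∘ ((ng ⊗ w) ∘ (bs ∘ (ga S ⊗ w) ∘ bs) ∘ (ng ⊗ w)) ∘
  (bs ∘ (ga (invmx S) ⊗ w) ∘ bs).
Proof.
move=> hS; have th V : ty 1 (hg V) by typ. have tk V : ty 1 (kg V) by typ.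
have tn := ty_ng R q erefl.
rewrite !bs_ga0_bs -hg_kg_ga -hg_mul.
have n0k0 : (ng ⊗ w) ∘ (kg S ⊗ w) = (hg S ⊗ w) ∘ (ng ⊗ w).
  by rewrite !(parwl (n := 1)) -?hg_ng //; typ.
rw n0k0; rw (par2_comm tn (th S)).
kill ng0ng0; rw (par2_comm (tk (invmx S)) (th S)).
rewrite -[_ ∘ (w ⊗ hg S) ∘ _]seqA (parwr (n := 1)) // [hg S ∘ hg (invmx S)]hg_mul mulmxV // hg1 -[w ⊗ w]idd2.
rewrite seqd1; last by typ.
rewrite !(parwl (n := 1)); try typ; congr (_ ⊗ _).
by rewrite -!seqA hg_kg [kg S ∘ _]seqA kg_mul mulmxV // kg1 -idd1 seq1d; try typ.
Qed.

Lemma tfree_gL n j U : (1 < n)%N -> (j < n.*2)%N -> U \in unitmx -> tfree n (gL n j U).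
Proof.
move=> hn hj hU; have [S hS] := sqrtmx hU.
have uS : S \in unitmx by move: hU; rewrite -hS unitmx_mul => /andP[].
have n0 : tfree 2 (ng ⊗ w) by apply: tfree_par11; [apply: tfree_ng | apply: tfree_w].
have n1 : tfree 2 (w ⊗ ng) by apply: tfree_par11; [apply: tfree_w | apply: tfree_ng].
have h0 : tfree 2 (hg U ⊗ w).
  have g V : tfree 2 (ga V ⊗ w) by apply: tfree_par11; [apply: tfree_ga | apply: tfree_w].
  have b := tfree_bs.
  by rewrite -hS hg_sqr_w //; do 6?apply: tfree_seq => //.
have th : ty 1 (hg U) by typ.
have h1 : tfree 2 (w ⊗ hg U).
  have -> : w ⊗ hg U = sw ∘ (hg U ⊗ w) ∘ sw by rewrite sw_par' //; kill sw_sw.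
  by have s := tfree_sw; do 2?apply: tfree_seq.
have k0 : tfree 2 (kg U ⊗ w).
  rewrite kgE -!(parwl (n := 1)); try typ.
  by do 2?apply: tfree_seq.
have k1 : tfree 2 (w ⊗ kg U).
  rewrite kgE -!(parwr (n := 1)); try typ.
  by do 2?apply: tfree_seq.
have [i ji] := parity j; have [lt|ge] := ltnP i.+1 n.
  have e : n = (i + 2 + (n - i - 2))%N by lia.
  by case: ji => ->; rewrite ?(gL0 _ e) ?(gL1 _ e); apply: tfree_whisker e.
(* The mode lies on the last wire, so the two-wire window must begin one wire earlier, which exists
   because of [hn]. *)
case: i ji ge => [|i] ji ge; first by lia.
have e : n = (i + 2 + 0)%N by lia.
by case: ji => ->; rewrite doubleS ?(gL2 _ e) ?(gL3 _ e); apply: tfree_whisker e.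
Qed.

Lemma word_tfree n x : (1 < n)%N -> word n n.*2 x -> tfree n x.
Proof.
move=> hn; elim=> [|j {}x hj _ IH|j U {}x hj hU _ IH]; first exact: tfree_idd.
  by apply: tfree_seq => //; apply: tfree_sL.
by apply: tfree_seq => //; apply: tfree_gL.
Qed.

End TraceElimination.

Theorem proposition26 (R : realType) (q n : nat) (hq : (1 <= q)%N)
    (hn : (2 <= n)%N) (D : term R q) (hD : has_type D n)
    (hinv : forall U : 'M[R[i]]_q, gate_in U D -> U \in unitmx) :
  exists D' : term R q, trace_free n D' /\ PBS ⊢ D ≡ D' : n.
Proof.
have [D' [hD' tD' e]] := word_tfree hn (word_cls hD hinv).
exists D'; split; first by exists D'; split=> //; apply: cong_refl.
exact: cls_eqP hD (esym e).
Qed.
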